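(* Let $\Lambda$ be a finite dimensional algebra over a field $K$. Then $$\operatorname{Findim}\Lambda^{\mathrm{op}} = \operatorname{edell}\Lambda \le \operatorname{ddell}\Lambda \le \operatorname{dell}\Lambda \qquad\text{and}\qquad \operatorname{Findim}\Lambda^{\mathrm{op}} = \operatorname{edell}\Lambda \le \operatorname{sub\text{-}ddell}\Lambda \le \operatorname{dell}\Lambda .$$
   Context: Modules are right $\Lambda$-modules; left $\Lambda$-modules are $\Lambda^{\mathrm{op}}$-modules. $\mathrm{Mod}\,\Lambda$ is the category of all right $\Lambda$-modules, $\mathrm{mod}\,\Lambda$ the category of finitely generated ones. $\mathbb N$ is the set of nonnegative integers; the infimum of the empty set is $+\infty$; all invariants take values in $\mathbb N\cup\{\infty\}$. For a module $M$, $\Omega M$ is the kernel of a projective cover $P_M\to M$, $\Omega^0M=M$, $\Omega^{n+1}M=\Omega(\Omega^nM)$. $\mathrm{pd}$ and $\mathrm{id}$ denote projective and injective dimension. $\operatorname{Findim}\Lambda^{\mathrm{op}}=\sup\{\mathrm{pd}\,M\mid M\in \mathrm{Mod}\,\Lambda^{\mathrm{op}},\ \mathrm{pd}\,M<\infty\}$. ''$A$ is a direct summand of $B$ up to projective summands'' means that $A$ is isomorphic to a direct summand of $B\oplus P$ for some projective $P$. For an integer $k\ge 0$ and a module $M$, the $k$-delooping level is $$k\text{-}\operatorname{dell}M=\inf\{n\in\mathbb N\mid \Omega^nM\text{ is a direct summand of }\Omega^{n+k}N\text{ up to projective summands, for some }N\in\mathrm{mod}\,\Lambda\},$$ and $\operatorname{dell}M=1\text{-}\operatorname{dell}M$.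 The effective delooping level $\operatorname{edell}M$ is the infimum of all $n\in\mathbb N$ such that for every integer $k'\ge1$ and every $X\in\mathrm{Mod}\,\Lambda$ with $\mathrm{id}\,X=n+k'$ one has $\mathrm{Ext}^{n+k'}_\Lambda(M,X)=0$. The sub-derived delooping level is $\operatorname{sub\text{-}ddell}M=\inf\{\operatorname{dell}N\mid N\in\mathrm{mod}\,\Lambda,\ M\text{ embeds in }N\}$. The derived delooping level $\operatorname{ddell}M$ is the infimum of all $m\in\mathbb N$ for which there exist an integer $0\le n\le m$ and an exact sequence $0\to C_n\to C_{n-1}\to\cdots\to C_1\to C_0\to M\to0$ in $\mathrm{mod}\,\Lambda$ with $(i+1)\text{-}\operatorname{dell}C_i\le m-i$ for $i=0,1,\dots,n$. For each of $\operatorname{dell},\operatorname{edell},\operatorname{sub\text{-}ddell},\operatorname{ddell}$, the value on $\Lambda$ is the supremum of the values on the simple right $\Lambda$-modules. *)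

(* Defs.v *)
From HB Require Import structures.
From mathcomp Require Import all_boot all_order all_algebra all_field.
From mathcomp Require Import boolp.
Set Implicit Arguments.
Unset Strict Implicit.
Unset Printing Implicit Defensive.
Import GRing.Theory.
Local Open Scope ring_scope.

Declare Scope enat_scope.
Delimit Scope enat_scope with enat.

Variant enat : Type := Fin of nat | Infty.

Definition enat_le (x y : enat) : bool :=
  match x, y with
  | _, Infty => true
  | Fin m, Fin n => (m <= n)%N
  | Infty, Fin _ => false
  end.
Notation "x <= y" := (enat_le x y) : enat_scope.

Definition nat_inf (A : nat -> Prop) : enat :=
  match pselect (exists n, `[< A n >]) with
  | left exA => Fin (ex_minn exA)
  | right _ => Infty
  end.

(* The element oo never affects an infimum, so only the finite elements of A
   matter. *)
Definition enat_inf (A : enat -> Prop) : enat := nat_inf (fun n => A (Fin n)).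

(* The least upper bound: oo if A has no upper bound in N; the supremum of the
   empty set is 0. *)
Definition enat_sup (A : enat -> Prop) : enat :=
  nat_inf (fun n => forall x, A x -> (x <= Fin n)%enat).

(* Everything below is stated for the category [lmodType R] of all left modules
   over a ring R.  Right modules over an algebra L are left modules over the
   converse ring L^c, that is, [lmodType L^c]; left L-modules, i.e. modules
   over the opposite algebra, are [lmodType L]. *)

Definition surjective_map (A B : Type) (f : A -> B) : Prop :=
  forall y, exists x, f x = y.

Definition exact_at (R : pzRingType) (A B C : lmodType R)
    (f : {linear A -> B}) (g : {linear B -> C}) : Prop :=
  forall y, g y = 0 <-> exists x, f x = y.

Definition lmod_iso (R : pzRingType) (M N : lmodType R) : Prop :=
  exists f : {linear M -> N}, bijective f.

Definition embeds (R : pzRingType) (M N : lmodType R) : Prop :=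
  exists f : {linear M -> N}, injective f.

Definition zero_mod (R : pzRingType) (M : lmodType R) : Prop :=
  forall x : M, x = 0.

Definition fin_gen (R : pzRingType) (M : lmodType R) : Prop :=
  exists (n : nat) (g : 'I_n -> M),
    forall x, exists a : 'I_n -> R, x = \sum_(i < n) a i *: g i.

Definition simple_mod (R : pzRingType) (M : lmodType R) : Prop :=
  ~ zero_mod M /\
  forall U : {pred M}, submod_closed U ->
    (forall x, x \in U -> x = 0) \/ (forall x, x \in U).

Definition projective_mod (R : pzRingType) (P : lmodType R) : Prop :=
  forall (A B : lmodType R) (p : {linear A -> B}) (f : {linear P -> B}),
    surjective_map p -> exists g : {linear P -> A}, forall x, p (g x) = f x.

Definition injective_mod (R : pzRingType) (I : lmodType R) : Prop :=
  forall (A B : lmodType R) (j : {linear A -> B}) (f : {linear A -> I}),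
    injective j -> exists g : {linear B -> I}, forall x, g (j x) = f x.

(* The kernel of p is superfluous: U + ker p = P implies U = P. *)
Definition superfluous_kernel (R : pzRingType) (P M : lmodType R)
    (p : {linear P -> M}) : Prop :=
  forall U : {pred P}, submod_closed U ->
    (forall x, exists u k, [/\ u \in U, p k = 0 & x = u + k]) ->
    forall x, x \in U.

Definition projective_cover (R : pzRingType) (P M : lmodType R)
    (p : {linear P -> M}) : Prop :=
  [/\ projective_mod P, surjective_map p & superfluous_kernel p].

(* Syzygies are determined up to isomorphism only, so they are handled as
   relations: [syzygy K M] reads "K is (isomorphic to) Omega M", and
   [nsyzygy n K M] reads "K is (isomorphic to) Omega^n M". *)
Definition syzygy (R : pzRingType) (K M : lmodType R) : Prop :=
  exists (P : lmodType R) (p : {linear P -> M}) (i : {linear K -> P}),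
    [/\ projective_cover p, injective i & exact_at i p].

Fixpoint nsyzygy (R : pzRingType) (n : nat) (K M : lmodType R) : Prop :=
  match n with
  | 0%N => lmod_iso K M
  | m.+1 => exists L : lmodType R, nsyzygy m L M /\ syzygy K L
  end.

(* A is isomorphic to a direct summand of B (+) P for some projective P. *)
Definition summand_up_to_proj (R : pzRingType) (A B : lmodType R) : Prop :=
  exists P C : lmodType R,
    projective_mod P /\ lmod_iso (A * C)%type (B * P)%type.

(* An exact sequence ... -> C_2 -> C_1 -> C_0 -> M -> 0. *)
Record resolution (R : pzRingType) (M : lmodType R) := Resolution {
  res_obj :> nat -> lmodType R;
  res_diff : forall i, {linear res_obj i.+1 -> res_obj i};
  res_aug : {linear res_obj 0 -> M};
  res_aug_surj : surjective_map res_aug;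
  res_aug_exact : exact_at (res_diff 0) res_aug;
  res_diff_exact : forall i, exact_at (res_diff i.+1) (res_diff i)
}.

(* An exact sequence 0 -> M -> I^0 -> I^1 -> I^2 -> ... *)
Record coresolution (R : pzRingType) (M : lmodType R) := Coresolution {
  cores_obj :> nat -> lmodType R;
  cores_diff : forall i, {linear cores_obj i -> cores_obj i.+1};
  cores_aug : {linear M -> cores_obj 0};
  cores_aug_inj : injective cores_aug;
  cores_aug_exact : exact_at cores_aug (cores_diff 0);
  cores_diff_exact : forall i, exact_at (cores_diff i) (cores_diff i.+1)
}.

(* The terms of index > n vanish; for a resolution C of M this says that C is
   an exact sequence 0 -> C_n -> ... -> C_0 -> M -> 0. *)
Definition length_le (R : pzRingType) (n : nat) (C : nat -> lmodType R) : Prop :=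
  forall i, (n < i)%N -> zero_mod (C i).

Definition projdim (R : pzRingType) (M : lmodType R) : enat :=
  nat_inf (fun n => exists P : resolution M,
    (forall i, projective_mod (P i)) /\ length_le n P).

Definition injdim (R : pzRingType) (M : lmodType R) : enat :=
  nat_inf (fun n => exists I : coresolution M,
    (forall i, injective_mod (I i)) /\ length_le n I).

Definition cocycle (R : pzRingType) (M X : lmodType R) (P : resolution M)
    (n : nat) (f : {linear P n -> X}) : Prop :=
  forall x, f (res_diff P n x) = 0.

Definition coboundary (R : pzRingType) (M X : lmodType R) (P : resolution M)
    (n : nat) : {linear P n -> X} -> Prop :=
  match n return {linear P n -> X} -> Prop with
  | 0%N => fun f => forall x, f x = 0
  | m.+1 => fun f => exists g : {linear P m -> X},
                       forall x, f x = g (res_diff P m x)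
  end.

(* Ext^n(M, X) = 0, where Ext^n(M, X) is the n-th cohomology of the complex
   Hom(P, X) for a projective resolution P of M. *)
Definition Ext_zero (R : pzRingType) (n : nat) (M X : lmodType R) : Prop :=
  exists P : resolution M, (forall i, projective_mod (P i)) /\
    forall f : {linear P n -> X}, cocycle f -> coboundary f.

Definition kdell (R : pzRingType) (k : nat) (M : lmodType R) : enat :=
  nat_inf (fun n => exists N A B : lmodType R,
    [/\ fin_gen N, nsyzygy n A M, nsyzygy (n + k) B N
      & summand_up_to_proj A B]).

Definition dell (R : pzRingType) (M : lmodType R) : enat := kdell 1 M.

Definition edell (R : pzRingType) (M : lmodType R) : enat :=
  nat_inf (fun n => forall k : nat, (1 <= k)%N ->
    forall X : lmodType R, injdim X = Fin (n + k) -> Ext_zero (n + k) M X).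

Definition sub_ddell (R : pzRingType) (M : lmodType R) : enat :=
  enat_inf (fun v => exists N : lmodType R,
    [/\ fin_gen N, embeds M N & v = dell N]).

Definition ddell (R : pzRingType) (M : lmodType R) : enat :=
  nat_inf (fun m => exists (n : nat) (C : resolution M),
    [/\ (n <= m)%N, length_le n C, forall i, fin_gen (C i)
      & forall i, (i <= n)%N -> (kdell i.+1 (C i) <= Fin (m - i))%enat]).

Definition sup_simple (R : pzRingType) (inv : lmodType R -> enat) : enat :=
  enat_sup (fun v => exists S : lmodType R, simple_mod S /\ v = inv S).

Definition dell_ring (R : pzRingType) : enat := sup_simple (@dell R).
Definition edell_ring (R : pzRingType) : enat := sup_simple (@edell R).
Definition sub_ddell_ring (R : pzRingType) : enat := sup_simple (@sub_ddell R).
Definition ddell_ring (R : pzRingType) : enat := sup_simple (@ddell R).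

Definition Findim (R : pzRingType) : enat :=
  enat_sup (fun v => exists M : lmodType R,
    projdim M <> Infty /\ v = projdim M).

(* Main.v *)
Require Import Defs.
From HB Require Import structures.
From mathcomp Require Import all_boot all_order all_algebra all_field.
From mathcomp Require Import boolp classical_sets.

(** Write D = Hom_K(-, K).  A module is projective (injective) exactly when the
    multiplication map of its free module splits (its embedding into its cofree
    module splits), and such a splitting is a family of K-linear endomorphisms;
    transposing them shows that D exchanges projectives and injectives.

    Findim <= edell: let pd M = n exceed edell, with resolution P.  Then
    Ext^n(S, DM) = 0 for all simple S, so every map from a simple module to
    DP_n lifts to DP_(n-1); by Zorn's lemma and the injectivity of DP_(n-1) the
    map DP_(n-1) -> DP_n splits.  As P_n is a retract of its bidual,
    P_n -> P_(n-1) splits too, whence pd M < n.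

    edell <= Findim: let id X = n exceed Findim, with injective coresolution I.
    Then pd DX < n, so Ext^n(-, DDX) = 0, and maps from simple modules to
    DDI^n lift to DDI^(n-1).  By linear duality the lifts descend to
    I^(n-1) -> I^n, which therefore splits, whence id X < n.

    The bounds by ddell and sub-ddell are dimension shifting, computing
    Ext(-, X) from an injective coresolution of X of length id X. *)

Set Implicit Arguments.
Unset Strict Implicit.
Unset Printing Implicit Defensive.
Import GRing.Theory.
Local Open Scope ring_scope.

(** * Extended natural numbers *)

Lemma nat_inf_leP (A : nat -> Prop) n :
  (nat_inf A <= Fin n)%enat <-> exists2 m, (m <= n)%N & A m.
Proof.
rewrite /nat_inf; case: pselect => [exA|nA]; split=> //=.
- by case: ex_minnP => m /asboolP Am _ le_mn; exists m.
- by case=> m le_mn Am; case: ex_minnP => p _ /(_ m (asboolT Am)) /leq_trans; apply.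
- by case=> m _ Am; case: nA; exists m; apply/asboolP.
Qed.

Lemma nat_inf_Fin (A : nat -> Prop) n : nat_inf A = Fin n -> A n.
Proof.
by rewrite /nat_inf; case: pselect => // exA; case: ex_minnP => m /asboolP Am _ [<-].
Qed.

Lemma enat_le_refl x : (x <= x)%enat.
Proof. by case: x => /=. Qed.

Lemma enat_le_trans y x z : (x <= y)%enat -> (y <= z)%enat -> (x <= z)%enat.
Proof. by case: x y z => [?|] [?|] [?|] //=; apply: leq_trans. Qed.

Lemma enat_le_anti x y : (x <= y)%enat -> (y <= x)%enat -> x = y.
Proof.
by case: x y => [a|] [b|] //= ab ba; congr Fin; apply/eqP; rewrite eqn_leq ab.
Qed.

Lemma enat_sup_ub (A : enat -> Prop) x : A x -> (x <= enat_sup A)%enat.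
Proof.
case E: (enat_sup A) => [n|]; last by case: x.
exact: (nat_inf_Fin E).
Qed.

Lemma enat_sup_le (A : enat -> Prop) y :
  (forall x, A x -> (x <= y)%enat) -> (enat_sup A <= y)%enat.
Proof.
case: y => [n|] H; last by case: (enat_sup A).
by apply/nat_inf_leP; exists n.
Qed.

Lemma sup_simple_le (R : pzRingType) (f g : lmodType R -> enat) :
  (forall S, simple_mod S -> (f S <= g S)%enat) ->
  (sup_simple f <= sup_simple g)%enat.
Proof.
move=> H; apply: enat_sup_le => _ [S [simS ->]].
by apply: enat_le_trans (H _ simS) _; apply: enat_sup_ub; exists S.
Qed.

(** * Submodules, quotients and factorisations *)

Lemma linear_exists (R : pzRingType) (A B : lmodType R) (f : A -> B) :
  linear f -> exists g : {linear A -> B}, forall x, g x = f x.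
Proof.
move=> lf; pose g : {linear A -> B} := HB.pack f (GRing.isLinear.Build R A B _ f lf).
by exists g.
Qed.

Section Submodule.
Variables (R : pzRingType) (A : lmodType R) (U : {pred A}).
Hypothesis subU : submod_closed U.

(** The closure proof is an argument so that the closed-predicate structure, which depends on it,
    can be inferred. *)
Definition sub_pred of submod_closed U : {pred A} := U.
HB.instance Definition _ := GRing.isSubmodClosed.Build R A (sub_pred subU) subU.

Definition submod := {x : A | x \in sub_pred subU}.
HB.instance Definition _ := SubChoice.on submod.
HB.instance Definition _ := [SubChoice_isSubLmodule of submod by <:].

Definition sub_incl : {linear submod -> A} := val.

Lemma sub_incl_inj : injective sub_incl.
Proof. exact: val_inj. Qed.

Lemma sub_inclP x : x \in U <-> exists u, sub_incl u = x.
Proof.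
split=> [Ux|[[u /= Uu] <- //]].
by exists (exist _ x Ux).
Qed.
End Submodule.

Section Kernel.
Variables (R : pzRingType) (A B : lmodType R) (f : {linear A -> B}).

Definition in_ker : {pred A} := fun x => f x == 0.

Lemma in_ker_submod : submod_closed in_ker.
Proof.
split=> [|a x y]; rewrite !unfold_in /in_ker ?linear0 ?eqxx // => /eqP fx /eqP fy.
by rewrite linearP fx fy scaler0 addr0.
Qed.

Definition kermod := submod in_ker_submod.
Definition ker_incl : {linear kermod -> A} := @sub_incl _ _ _ in_ker_submod.

Lemma ker_incl_inj : injective ker_incl.
Proof. exact: sub_incl_inj. Qed.

Lemma ker_incl_exact : exact_at ker_incl f.
Proof.
move=> y; split=> [/eqP fy|]; first exact/(@sub_inclP _ _ _ in_ker_submod).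
by move/(@sub_inclP _ _ _ in_ker_submod)/eqP.
Qed.
End Kernel.

Section Quotient.
Variables (R : pzRingType) (A : lmodType R) (U : {pred A}).
Hypothesis subU : submod_closed U.

Let U0 : 0 \in U. Proof. by case: subU. Qed.
Let UP a x y : x \in U -> y \in U -> a *: x + y \in U.
Proof. by case: subU => _; apply. Qed.
Let UD x y : x \in U -> y \in U -> x + y \in U.
Proof. by move=> Ux; rewrite -[x]scale1r; apply: UP. Qed.
Let UZ a x : x \in U -> a *: x \in U.
Proof. by move=> Ux; rewrite -[_ *: _]addr0 UP. Qed.
Let UN x : x \in U -> - x \in U.
Proof. by move=> Ux; rewrite -scaleN1r UZ. Qed.

(* The representative of the coset of [x], chosen from the coset alone. *)
Definition qrepr of submod_closed U := fun x : A =>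
  xget 0 [set y | y - x \in U]%classic.
Let qr := qrepr subU.

Lemma qrepr_sub x : qr x - x \in U.
Proof.
by apply: (@xgetPex _ 0 [set y | y - x \in U]%classic); exists x => /=; rewrite subrr.
Qed.

Lemma qrepr_eq x y : x - y \in U -> qr x = qr y.
Proof.
move=> Uxy; rewrite /qr /qrepr; congr (xget 0); apply/seteqP; split=> z /= Uz.
  by rewrite -(subrK x z) -addrA UD.
by rewrite -(subrK y z) -addrA UD // -opprB UN.
Qed.

Lemma qrepr_inj x y : qr x = qr y -> x - y \in U.
Proof.
move=> E; rewrite -(subrK (qr x) x) -addrA UD //; last by rewrite E qrepr_sub.
by rewrite -opprB UN ?qrepr_sub.
Qed.

Lemma qrepr_idem x : qr (qr x) = qr x.
Proof. exact/qrepr_eq/qrepr_sub. Qed.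

(** Cosets are represented by their chosen elements, so that the quotient is a subtype of [A]. *)
Definition quotmod := {x : A | qrepr subU x == x}.
HB.instance Definition _ := Choice.on quotmod.

Definition qpi (x : A) : quotmod := exist _ (qr x) (introT eqP (qrepr_idem x)).

Lemma qpiP x y : qpi x = qpi y <-> x - y \in U.
Proof.
by split=> [[/qrepr_inj] //|/qrepr_eq E]; apply: val_inj.
Qed.

Lemma qpi_val (u : quotmod) : qpi (val u) = u.
Proof. by apply: val_inj; apply/eqP; case: u. Qed.

Let val_qpi x : val (qpi x) - x \in U. Proof. exact: qrepr_sub. Qed.

Let qadd (u v : quotmod) := qpi (val u + val v).
Let qopp (u : quotmod) := qpi (- val u).
Let qscale a (u : quotmod) := qpi (a *: val u).

Let qaddE x y : qadd (qpi x) (qpi y) = qpi (x + y).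
Proof. by apply/qpiP; rewrite opprD addrACA UD. Qed.
Let qoppE x : qopp (qpi x) = qpi (- x).
Proof. by apply/qpiP; rewrite -opprD UN. Qed.
Let qscaleE a x : qscale a (qpi x) = qpi (a *: x).
Proof. by apply/qpiP; rewrite -scalerBr UZ. Qed.

Let qaddA : associative qadd.
Proof. by move=> u v w; rewrite -(qpi_val u) -(qpi_val v) -(qpi_val w) !qaddE addrA. Qed.
Let qaddC : commutative qadd.
Proof. by move=> u v; rewrite /qadd addrC. Qed.
Let qadd0 : left_id (qpi 0) qadd.
Proof. by move=> u; rewrite -(qpi_val u) qaddE add0r. Qed.
Let qaddN : left_inverse (qpi 0) qopp qadd.
Proof. by move=> u; rewrite -(qpi_val u) qoppE qaddE addNr. Qed.

HB.instance Definition _ := GRing.isZmodule.Build quotmod qaddA qaddC qadd0 qaddN.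

Let qscaleA a b u : qscale a (qscale b u) = qscale (a * b) u.
Proof. by rewrite -(qpi_val u) !qscaleE scalerA. Qed.
Let qscale1 : left_id 1 qscale.
Proof. by move=> u; rewrite -(qpi_val u) qscaleE scale1r. Qed.
Let qscaleDr : right_distributive qscale +%R.
Proof.
by move=> a u v; rewrite -(qpi_val u) -(qpi_val v) [_ + _]qaddE !qscaleE [RHS]qaddE scalerDr.
Qed.
Let qscaleDl u : {morph qscale^~ u : a b / a + b}.
Proof. by move=> a b; rewrite -(qpi_val u) !qscaleE [RHS]qaddE scalerDl. Qed.

HB.instance Definition _ := GRing.Zmodule_isLmodule.Build R quotmod
  qscaleA qscale1 qscaleDr qscaleDl.

Let qpi_linear : linear qpi.
Proof. by move=> a x y; rewrite -[RHS]/(qadd (qscale a (qpi x)) (qpi y)) qscaleE qaddE. Qed.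
HB.instance Definition _ := GRing.isLinear.Build R A quotmod _ qpi qpi_linear.

Lemma qpi_eq0 x : qpi x = 0 <-> x \in U.
Proof. by rewrite -[in X in X <-> _](linear0 qpi) qpiP subr0. Qed.
End Quotient.

Section Factor.
Variables (R : pzRingType).
Implicit Types A B C N P : lmodType R.

Lemma factor_surj A B C N (i : {linear A -> B}) (p : {linear B -> C})
    (f : {linear B -> N}) :
  surjective_map p -> exact_at i p -> (forall x, f (i x) = 0) ->
  exists g : {linear C -> N}, forall x, g (p x) = f x.
Proof.
move=> sp ex f0; have [s sK] := choice sp.
have fE x y : p x = p y -> f x = f y.
  move=> pxy; have /ex[z E]: p (x - y) = 0 by rewrite linearB pxy subrr.
  by apply/eqP; rewrite -subr_eq0 -linearB -E f0.
have [|g gE] := @linear_exists _ C N (f \o s).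
  by move=> a x y /=; rewrite -linearP; apply: fE; rewrite linearP !sK.
by exists g => x; rewrite gE /=; apply: fE; rewrite sK.
Qed.

Lemma factor_inj A B C N (i : {linear A -> B}) (p : {linear B -> C})
    (f : {linear N -> B}) :
  injective i -> exact_at i p -> (forall x, p (f x) = 0) ->
  exists g : {linear N -> A}, forall x, i (g x) = f x.
Proof.
move=> ii ex f0; have [s sK] := choice (fun x => (ex (f x)).1 (f0 x)).
have [|g gE] := @linear_exists _ N A s; last by exists g => x; rewrite gE.
by move=> a x y; apply: ii; rewrite !linearP !sK linearP.
Qed.

(** Both [f] and [u] factor through the kernel of [v], onto which [u] is surjective by exactness. *)
Lemma proj_lift_exact P A B C (u : {linear A -> B}) (v : {linear B -> C})
    (f : {linear P -> B}) :
  projective_mod P -> exact_at u v -> (forall x, v (f x) = 0) ->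
  exists g : {linear P -> A}, forall x, u (g x) = f x.
Proof.
move=> prP ex vf.
have iK := @ker_incl_inj _ _ _ v; have eK := @ker_incl_exact _ _ _ v.
have [f' f'E] := factor_inj iK eK vf.
have [u' u'E] := factor_inj iK eK (fun x => (ex (u x)).2 (ex_intro _ x erefl)).
have [|g gE] := prP _ _ u' f'.
  move=> y; have /ex[x xE] : v (ker_incl v y) = 0 by apply/eK; exists y.
  by exists x; apply: iK; rewrite u'E.
by exists g => x; rewrite -f'E -gE u'E.
Qed.

Definition zmod0 : lmodType R := 'rV[R]_0.
Lemma zmod0P : zero_mod zmod0.
Proof. by move=> x; apply/rowP; case. Qed.

Lemma zero_projective A : zero_mod A -> projective_mod A.
Proof.
move=> zA B C p f _; exists (\0 : {linear A -> B}) => x.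
by rewrite (zA x) !linear0.
Qed.

Lemma zero_injective A : zero_mod A -> injective_mod A.
Proof.
move=> zA B C j f _; exists (\0 : {linear C -> A}) => x.
by rewrite [RHS]zA.
Qed.

Lemma simple_cyclic A : simple_mod A -> exists x0 : A, forall x, exists a, x = a *: x0.
Proof.
case=> nz simA; have /existsNP[x0 /eqP nx0] := nz.
pose U : {pred A} := fun x => `[< exists a, x = a *: x0 >].
have subU : submod_closed U.
  split; first by apply/asboolP; exists 0; rewrite scale0r.
  move=> a x y /asboolP[b ->] /asboolP[c ->]; apply/asboolP; exists (a * b + c).
  by rewrite scalerDl scalerA.
case: (simA U subU) => [H|H]; last by exists x0 => x; apply/asboolP/H.
by case/eqP: nx0; apply: H; apply/asboolP; exists 1; rewrite scale1r.
Qed.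

Lemma simple_fin_gen A : simple_mod A -> fin_gen A.
Proof.
case/simple_cyclic=> x0 x0P; exists 1%N, (fun=> x0) => x; have [a ->] := x0P x.
by exists (fun=> a); rewrite big_ord1.
Qed.
End Factor.

(** * Ext through injective coresolutions *)

Section Shift.
Variables (R : pzRingType).
Implicit Types A B C M N X : lmodType R.

Lemma res_diff_diff M (Q : resolution M) i x : res_diff Q i (res_diff Q i.+1 x) = 0.
Proof. by apply/res_diff_exact; exists x. Qed.

Lemma res_aug_diff M (Q : resolution M) x : res_aug Q (res_diff Q 0 x) = 0.
Proof. by apply/res_aug_exact; exists x. Qed.

Lemma cores_diff_diff X (I : coresolution X) i x :
  cores_diff I i.+1 (cores_diff I i x) = 0.
Proof. by apply/cores_diff_exact; exists x. Qed.

Lemma cores_diff_aug X (I : coresolution X) x : cores_diff I 0 (cores_aug I x) = 0.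
Proof. by apply/cores_aug_exact; exists x. Qed.

Section ResShift.
Variables (M : lmodType R) (Q : resolution M).
Let K := kermod (res_aug Q).
Let aug_ex := factor_inj (@ker_incl_inj _ _ _ (res_aug Q))
  (@ker_incl_exact _ _ _ (res_aug Q)) (@res_aug_diff M Q).
Definition shift_aug : {linear Q 1 -> K} := projT1 (cid aug_ex).

Lemma shift_augE x : ker_incl (res_aug Q) (shift_aug x) = res_diff Q 0 x.
Proof. by rewrite /shift_aug; case: (cid _). Qed.

Lemma shift_aug_surj : surjective_map shift_aug.
Proof.
move=> y; have /res_aug_exact[x xE] : res_aug Q (ker_incl (res_aug Q) y) = 0.
  by apply/ker_incl_exact; exists y.
by exists x; apply: (@ker_incl_inj _ _ _ (res_aug Q)); rewrite shift_augE.
Qed.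

Lemma shift_aug_exact : exact_at (res_diff Q 1) shift_aug.
Proof.
move=> y; split=> [E|/res_diff_exact E].
  by apply/res_diff_exact; rewrite -shift_augE E linear0.
by apply: (@ker_incl_inj _ _ _ (res_aug Q)); rewrite shift_augE linear0.
Qed.

(** Dropping [Q 0] leaves a resolution of the kernel of the augmentation; inductions on the degree
    pass from [M] to this kernel. *)
Definition shift_res : resolution K :=
  @Resolution R K (fun i => Q i.+1) (fun i => res_diff Q i.+1) shift_aug
    shift_aug_surj shift_aug_exact (fun i => @res_diff_exact _ _ Q i.+1).
End ResShift.

Section CoresShift.
Variables (X : lmodType R) (I : coresolution X).
Let Y := kermod (cores_diff I 1).

Definition shift_cores : coresolution Y :=
  @Coresolution R Y (fun i => I i.+1) (fun i => cores_diff I i.+1)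
    (ker_incl (cores_diff I 1)) (@ker_incl_inj _ _ _ _) (@ker_incl_exact _ _ _ _)
    (fun i => @cores_diff_exact _ _ I i.+1).

(** The image of the first differential is the kernel of the second, so this kernel serves as the
    cokernel of [cores_aug I]. *)
Lemma cosyzygy_map : exists p : {linear I 0 -> Y},
  [/\ surjective_map p, exact_at (cores_aug I) p
    & forall x, ker_incl (cores_diff I 1) (p x) = cores_diff I 0 x].
Proof.
have iK := @ker_incl_inj _ _ _ (cores_diff I 1).
have [p pE] := factor_inj iK (@ker_incl_exact _ _ _ _) (@cores_diff_diff X I 0).
exists p; split=> // y.
  have /cores_diff_exact[x xE] : cores_diff I 1 (ker_incl (cores_diff I 1) y) = 0.
    by apply/ker_incl_exact; exists y.
  by exists x; apply: iK; rewrite pE.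
split=> [E|/cores_aug_exact E].
  by apply/cores_aug_exact; rewrite -pE E linear0.
by apply: iK; rewrite pE linear0.
Qed.
End CoresShift.

Section Splice.
Variables (M K P : lmodType R) (i : {linear K -> P}) (p : {linear P -> M}).
Hypotheses (ii : injective i) (sp : surjective_map p) (ex : exact_at i p).
Variable Q : resolution K.

Definition splice_obj n : lmodType R := if n is m.+1 then Q m else P.
Definition splice_diff n : {linear splice_obj n.+1 -> splice_obj n} :=
  match n return {linear splice_obj n.+1 -> splice_obj n} with
  | 0%N => (i \o res_aug Q : {linear Q 0 -> P}) | m.+1 => res_diff Q m end.

Lemma splice_aug_exact : exact_at (splice_diff 0) p.
Proof.
move=> y; split=> [/ex[k <-]|[x <-]]; last by apply/ex; exists (res_aug Q x).
by have [x <-] := @res_aug_surj _ _ Q k; exists x.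
Qed.

Lemma splice_diff_exact n : exact_at (splice_diff n.+1) (splice_diff n).
Proof.
case: n => [|n]; last exact: res_diff_exact.
move=> y; rewrite -(@res_aug_exact _ _ Q) /=; split=> [|->]; last by rewrite linear0.
by rewrite -(linear0 i) => /ii.
Qed.

Definition splice_res : resolution M :=
  @Resolution R M splice_obj splice_diff p sp splice_aug_exact splice_diff_exact.
End Splice.

Section Cosplice.
Variables (X I Y : lmodType R) (i : {linear X -> I}) (p : {linear I -> Y}).
Hypotheses (ii : injective i) (sp : surjective_map p) (ex : exact_at i p).
Variable J : coresolution Y.

Definition cosplice_obj n : lmodType R := if n is m.+1 then J m else I.
Definition cosplice_diff n : {linear cosplice_obj n -> cosplice_obj n.+1} :=
  match n return {linear cosplice_obj n -> cosplice_obj n.+1} with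
  | 0%N => (cores_aug J \o p : {linear I -> J 0}) | m.+1 => cores_diff J m end.

Lemma cosplice_aug_exact : exact_at i (cosplice_diff 0).
Proof.
move=> y; rewrite -ex /=; split=> [|->]; last by rewrite linear0.
by rewrite -(linear0 (cores_aug J)) => /cores_aug_inj.
Qed.

Lemma cosplice_diff_exact n : exact_at (cosplice_diff n) (cosplice_diff n.+1).
Proof.
case: n => [|n]; last exact: cores_diff_exact.
move=> y; split=> [/cores_aug_exact[z <-]|[x <-]]; last exact: cores_diff_aug.
by have [x <-] := sp z; exists x.
Qed.

Definition cosplice_cores : coresolution X :=
  @Coresolution R X cosplice_obj cosplice_diff i ii
    cosplice_aug_exact cosplice_diff_exact.
End Cosplice.

Definition trivial_res_obj M n : lmodType R := if n is 0%N then M else zmod0 R.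

Lemma trivial_res M : exists C : resolution M, res_obj C = trivial_res_obj M.
Proof.
have i0 : exact_at (\0 : {linear zmod0 R -> M}) (idfun : {linear M -> M}).
  by move=> y; split=> [/= ->|[x <-] //]; exists 0.
have z0 n : exact_at (\0 : {linear trivial_res_obj M n.+2 -> trivial_res_obj M n.+1})
    (\0 : {linear trivial_res_obj M n.+1 -> trivial_res_obj M n}).
  by move=> y; split=> // _; exists 0; rewrite linear0 [y]zmod0P.
have sid : surjective_map (idfun : {linear M -> M}) by move=> y; exists y.
by exists (@Resolution R M (trivial_res_obj M) (fun=> \0) idfun sid i0 z0).
Qed.

Lemma trivial_cores M : exists C : coresolution M, cores_obj C = trivial_res_obj M.
Proof.
have i0 : exact_at (idfun : {linear M -> M}) (\0 : {linear M -> zmod0 R}).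
  by move=> y; split=> // _; exists y.
have z0 n : exact_at (\0 : {linear trivial_res_obj M n -> trivial_res_obj M n.+1})
    (\0 : {linear trivial_res_obj M n.+1 -> trivial_res_obj M n.+2}).
  by move=> y; split=> // _; exists 0; rewrite linear0 [y]zmod0P.
have sid : injective (idfun : {linear M -> M}) by [].
by exists (@Coresolution R M (trivial_res_obj M) (fun=> \0) idfun sid i0 z0).
Qed.

Definition proj_le n M := exists Q : resolution M,
  (forall i, projective_mod (Q i)) /\ length_le n Q.
Definition inj_le n X := exists I : coresolution X,
  (forall i, injective_mod (I i)) /\ length_le n I.

Lemma proj_le0 M : projective_mod M -> proj_le 0 M.
Proof.
move=> pM; have [C E] := trivial_res M; exists C; rewrite E.
split=> [] [|i] //=; first exact/zero_projective/zmod0P.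
by move=> _; apply: zmod0P.
Qed.

Lemma inj_le0 M : injective_mod M -> inj_le 0 M.
Proof.
move=> pM; have [C E] := trivial_cores M; exists C; rewrite E.
split=> [] [|i] //=; first exact/zero_injective/zmod0P.
by move=> _; apply: zmod0P.
Qed.

Lemma retract_projective A B (f : {linear A -> B}) (g : {linear B -> A}) :
  cancel f g -> projective_mod B -> projective_mod A.
Proof.
move=> fK pB C D p h sp; have [k kE] := pB _ _ p (h \o g) sp.
by exists (k \o f) => x /=; rewrite kE /= fK.
Qed.

Lemma retract_injective A B (f : {linear A -> B}) (g : {linear B -> A}) :
  cancel f g -> injective_mod B -> injective_mod A.
Proof.
move=> fK iB C D j h ij; have [k kE] := iB _ _ j (f \o h) ij.
by exists (g \o k) => x /=; rewrite kE /= fK.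
Qed.

(** Passing to syzygies moves the split differential down to degree 0, where it makes [M] a retract
    of [Q 0]. *)
Lemma proj_le_pred n M (Q : resolution M) (r : {linear Q n -> Q n.+1}) :
  (forall i, projective_mod (Q i)) -> length_le n.+1 Q ->
  (forall x, r (res_diff Q n x) = x) -> proj_le n M.
Proof.
elim: n M Q r => [|n IH] M Q r pQ lQ rK; last first.
  have [Q' [pQ' lQ']] := IH _ (shift_res Q) r (fun i => pQ i.+1) (fun i => lQ i.+1) rK.
  exists (splice_res (@ker_incl_inj _ _ _ _) (@res_aug_surj _ _ Q)
    (@ker_incl_exact _ _ _ _) Q').
  by split=> [] [|i] //=; apply: lQ'.
apply: proj_le0.
(* [1 - d r] vanishes on the image of [d], since [r d = 1], and so descends to a section of the
   augmentation. *)
have [|||s sE] := @factor_surj _ _ _ _ _ (res_diff Q 0) (res_aug Q)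
    (idfun \- (res_diff Q 0 \o r)).
- exact: res_aug_surj.
- exact: res_aug_exact.
- by move=> x; rewrite /= rK subrr.
apply: (@retract_projective _ (Q 0) s (res_aug Q)) => // y.
have [x <-] := @res_aug_surj _ _ Q y.
by rewrite sE /= linearB res_aug_diff subr0.
Qed.

Lemma inj_le_pred n X (I : coresolution X) (s : {linear I n.+1 -> I n}) :
  (forall i, injective_mod (I i)) -> length_le n.+1 I ->
  (forall x, cores_diff I n (s x) = x) -> inj_le n X.
Proof.
elim: n X I s => [|n IH] X I s iI lI sK; last first.
  have [J [iJ lJ]] := IH _ (shift_cores I) s (fun i => iI i.+1) (fun i => lI i.+1) sK.
  have [p [sp ex _]] := cosyzygy_map I.
  exists (cosplice_cores (@cores_aug_inj _ _ I) sp ex J).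
  by split=> [] [|i] //=; apply: lJ.
apply: inj_le0.
(* [1 - s d] is killed by [d], since [d s = 1], and so takes values in [X]. *)
have [|||r rE] := @factor_inj _ _ _ _ _ (cores_aug I) (cores_diff I 0)
    (idfun \- (s \o cores_diff I 0)).
- exact: cores_aug_inj.
- exact: cores_aug_exact.
- by move=> x; rewrite /= linearB sK subrr.
apply: (@retract_injective _ (I 0) (cores_aug I) r) => // x.
by apply: (@cores_aug_inj _ _ I); rewrite rE /= cores_diff_aug linear0 subr0.
Qed.
End Shift.

(** * Vanishing of Ext and dimension shifting *)

Section Cohomology.
Variables (R : pzRingType).
Implicit Types A B C M N P X : lmodType R.

(* The vanishing of H^(n+1)(Hom(M, I)), that is, of Ext^(n+1)(M, X). *)
Definition coh_zero X (I : coresolution X) (n : nat) M : Prop :=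
  forall f : {linear M -> I n.+1}, (forall x, cores_diff I n.+1 (f x) = 0) ->
  exists g : {linear M -> I n}, forall x, cores_diff I n (g x) = f x.

Variables (X : lmodType R) (I : coresolution X).

Lemma coh_zero_proj n P : projective_mod P -> coh_zero I n P.
Proof. by move=> pP f; apply: proj_lift_exact => //; apply: cores_diff_exact. Qed.

Lemma coh_zero_length n m M : length_le n I -> (n <= m)%N -> coh_zero I m M.
Proof.
by move=> lI le_nm f _; exists \0 => x; rewrite [LHS](lI m.+1) ?[RHS](lI m.+1).
Qed.

Lemma coh_zero_retract n A B (f : {linear A -> B}) (g : {linear B -> A}) :
  cancel f g -> coh_zero I n B -> coh_zero I n A.
Proof.
move=> fK cB u u0; have [v vE] := cB (u \o g) (fun x => u0 (g x)).
by exists (v \o f) => x; rewrite /= vE /= fK.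
Qed.

Lemma coh_zero_prod n A B : coh_zero I n A -> coh_zero I n B ->
  coh_zero I n (A * B)%type.
Proof.
move=> cA cB f f0.
have [|iA iAE] := @linear_exists _ A (A * B)%type (fun x => (x, 0)).
  by move=> a x y; rewrite -[RHS]/(_, _) /= scaler0 addr0.
have [|iB iBE] := @linear_exists _ B (A * B)%type (fun x => (0, x)).
  by move=> a x y; rewrite -[RHS]/(_, _) /= scaler0 addr0.
have [g gE] := cA (f \o iA) (fun x => f0 _).
have [h hE] := cB (f \o iB) (fun x => f0 _).
exists ((g \o fst) \+ (h \o snd)) => -[x y]; rewrite /= linearD gE hE /=.
by rewrite -linearD iAE iBE; congr (f (_, _)); rewrite /= ?addr0 ?add0r.
Qed.

Hypothesis injI : forall i, injective_mod (I i).

(** This is exactness of [Ext^(n+1)(A, X) -> Ext^(n+2)(C, X) -> Ext^(n+2)(B, X)]. A solution [g] of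
    [d g = f p] is corrected by [d h'], after which it vanishes on [A] and descends to [C]. *)
Lemma coh_zero_cokernel n A B C (i : {linear A -> B}) (p : {linear B -> C}) :
  injective i -> surjective_map p -> exact_at i p ->
  coh_zero I n A -> coh_zero I n.+1 B -> coh_zero I n.+1 C.
Proof.
move=> ii sp ex cA cB f f0.
have pi x : p (i x) = 0 by apply/ex; exists x.
have [g gE] := cB (f \o p) (fun x => f0 (p x)).
have [|h hE] := cA (g \o i); first by move=> x; rewrite /= gE /= pi linear0.
have [h' h'E] := @injI n _ _ i h ii.
have [|k kE] := factor_surj (f := g \- (cores_diff I n \o h')) sp ex.
  by move=> x; rewrite /= h'E hE subrr.
exists k => y; have [x <-] := sp y.
by rewrite kE /= linearB gE cores_diff_diff subr0.
Qed.

(** This is exactness of [Ext^(n+1)(B, X) -> Ext^(n+1)(A, X) -> Ext^(n+2)(C, X)]; the cocycle [c] on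
    [C] represents the image of [f] under the connecting map. *)
Lemma coh_zero_kernel n A B C (i : {linear A -> B}) (p : {linear B -> C}) :
  injective i -> surjective_map p -> exact_at i p ->
  coh_zero I n B -> coh_zero I n.+1 C -> coh_zero I n A.
Proof.
move=> ii sp ex cB cC f f0.
have pi x : p (i x) = 0 by apply/ex; exists x.
have [f' f'E] := @injI n.+1 _ _ i f ii.
have [|c cE] := factor_surj (f := cores_diff I n.+1 \o f') sp ex.
  by move=> x; rewrite /= f'E f0.
have [|g gE] := cC c.
  by move=> y; have [x <-] := sp y; rewrite cE /= cores_diff_diff.
have [|h hE] := cB (f' \- (g \o p)).
  by move=> x; rewrite /= linearB gE cE subrr.
by exists (h \o i) => x; rewrite /= hE /= f'E pi linear0 subr0.
Qed.

(** In the top degree every map into [I n.+1] is a cocycle, in particular any extension of [f] to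
    [B]. *)
Lemma coh_zero_sub n A B (j : {linear A -> B}) :
  length_le n.+1 I -> injective j -> coh_zero I n B -> coh_zero I n A.
Proof.
move=> lI ij cB f f0; have [f' f'E] := @injI n.+1 _ _ j f ij.
have [|g gE] := cB f'; first by move=> x; apply: lI.
by exists (g \o j) => x; rewrite /= gE f'E.
Qed.

Lemma coh_zero_summand n A B : summand_up_to_proj A B ->
  coh_zero I n B -> coh_zero I n A.
Proof.
case=> P [C [pP [f [g gK Kg]]]] cB.
have [|iA iAE] := @linear_exists _ A (A * C)%type (fun x => (x, 0)).
  by move=> a x y; rewrite -[RHS]/(_, _) /= scaler0 addr0.
have [g' g'E] : exists g' : {linear (B * P)%type -> (A * C)%type}, g' =1 g.
  by apply: linear_exists; apply: (can2_linear gK Kg).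
apply: (@coh_zero_retract _ _ (B * P)%type (f \o iA) (fst \o g')).
  by move=> x; rewrite /= g'E gK iAE.
exact/coh_zero_prod/coh_zero_proj.
Qed.

Lemma coh_zero_iso n A B : lmod_iso A B -> coh_zero I n A <-> coh_zero I n B.
Proof.
case=> f [g fK gK].
have [g' g'E] : exists g' : {linear B -> A}, g' =1 g.
  by apply: linear_exists; apply: (can2_linear fK gK).
by split; [apply: (@coh_zero_retract _ _ _ g' f)|apply: (@coh_zero_retract _ _ _ f g')];
  move=> x; rewrite g'E.
Qed.

(** Each of the [p] steps is a short exact sequence with projective middle term, across which the
    degree shifts by one. *)
Lemma coh_zero_nsyzygy p n A M : nsyzygy p A M ->
  coh_zero I n A <-> coh_zero I (n + p) M.
Proof.
elim: p n A => [|p IH] n A /=; first by rewrite addn0; apply: coh_zero_iso.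
case=> L [nL [P [q [i [[pP sq _] ii ex]]]]]; rewrite addnS -addSn -(IH _ _ nL).
split; first by move=> cA; apply: coh_zero_cokernel ii sq ex cA (coh_zero_proj pP).
exact: coh_zero_kernel ii sq ex (coh_zero_proj pP).
Qed.

(** If [p <= m] attains the level, [Ext^(n+1)(M, X)] is [Ext^(n-p+1)] of the [p]-th syzygy of [M], a
    summand of the [(p+k)]-th syzygy of [N] up to projectives. For the latter that group is
    [Ext^(n+k+1)(N, X)], beyond the length of [I]. *)
Lemma coh_zero_kdell k m n M : (kdell k M <= Fin m)%enat -> length_le (n + k) I ->
  (m <= n)%N -> coh_zero I n M.
Proof.
case/nat_inf_leP=> p le_pm [N [A [B [_ nA nB sAB]]]] lI le_mn.
have le_pn := leq_trans le_pm le_mn.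
rewrite -(subnK le_pn) -(coh_zero_nsyzygy _ nA); apply: (coh_zero_summand sAB).
rewrite (coh_zero_nsyzygy _ nB) addnA subnK //.
exact: coh_zero_length lI _.
Qed.

Lemma coh_zero_res n q M (C : resolution M) : length_le n C -> (n <= q)%N ->
  (forall i, (i <= n)%N -> coh_zero I (q - i) (C i)) -> coh_zero I q M.
Proof.
elim: n q M C => [|n IH] q M C lC le_nq cC.
  have cC0 := cC 0%N isT; rewrite subn0 in cC0.
  (* Here [C 1] vanishes, so the augmentation is an isomorphism with inverse [s]. *)
  have [s sE] : exists s : {linear M -> C 0}, forall x, s (res_aug C x) = x.
    apply: (factor_surj (f := idfun)) (@res_aug_exact _ _ C) _.
      exact: res_aug_surj.
    by move=> x; rewrite [x](lC 1%N) // linear0.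
  apply: (@coh_zero_retract _ _ _ s (res_aug C)) cC0 => y.
  by have [x <-] := @res_aug_surj _ _ C y; rewrite sE.
case: q le_nq cC => // q le_nq cC.
apply: (coh_zero_cokernel (@ker_incl_inj _ _ _ (res_aug C)) (@res_aug_surj _ _ C)).
- exact: ker_incl_exact.
- apply: (IH q _ (shift_res C)) => // [i|i le_in]; first exact: (lC i.+1).
  exact: (cC i.+1).
- exact: (cC 0%N).
Qed.

(** Cocycles [Q 1 -> X] and [M -> I 1] are matched by maps [Q 0 -> I 0] that restrict to the former
    and induce the latter. Projectivity of [Q 0] or injectivity of [I 0] provides such a map. *)
Lemma Ext_coh0 M (Q : resolution M) : (forall i, projective_mod (Q i)) ->
  (forall f : {linear Q 1%N -> X}, cocycle f -> coboundary f) <-> coh_zero I 0 M.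
Proof.
move=> pQ; split=> [eQ f f0|cM f f0].
  have [g gE] := coh_zero_proj (pQ 0%N) (f := f \o res_aug Q) (fun x => f0 _).
  have [|||u uE] := @factor_inj _ _ _ _ _ (cores_aug I) (cores_diff I 0) (g \o res_diff Q 0).
  - exact: cores_aug_inj.
  - exact: cores_aug_exact.
  - by move=> x; rewrite /= gE /= res_aug_diff linear0.
  have [|h hE] := eQ u.
    move=> x; apply: (@cores_aug_inj _ _ I).
    by rewrite uE /= res_diff_diff !linear0.
  have [|k kE] := factor_surj (f := g \- (cores_aug I \o h))
      (@res_aug_surj _ _ Q) (@res_aug_exact _ _ Q).
    by move=> x; rewrite /= -hE uE subrr.
  exists k => y; have [x <-] := @res_aug_surj _ _ Q y.
  by rewrite kE /= linearB gE cores_diff_aug subr0.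
have [f' f'E] := factor_surj (@shift_aug_surj _ _ Q) (@shift_aug_exact _ _ Q) f0.
have [F FE] := injI (cores_aug I \o f') (@ker_incl_inj _ _ _ (res_aug Q)).
have [|c cE] := factor_surj (f := cores_diff I 0 \o F) (@res_aug_surj _ _ Q)
    (@ker_incl_exact _ _ _ (res_aug Q)).
  by move=> x; rewrite /= FE /= cores_diff_aug.
have [|g gE] := cM c.
  by move=> y; have [x <-] := @res_aug_surj _ _ Q y; rewrite cE /= cores_diff_diff.
have [|h hE] := factor_inj (f := F \- (g \o res_aug Q)) (@cores_aug_inj _ _ I)
    (@cores_aug_exact _ _ I).
  by move=> x; rewrite /= linearB gE cE subrr.
exists h => x; apply: (@cores_aug_inj _ _ I).
by rewrite hE /= res_aug_diff linear0 subr0 -shift_augE FE /= f'E.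
Qed.

Lemma Ext_coh n M (Q : resolution M) : (forall i, projective_mod (Q i)) ->
  (forall f : {linear Q n.+1 -> X}, cocycle f -> coboundary f) <-> coh_zero I n M.
Proof.
elim: n M Q => [|n IH] M Q pQ; first exact: Ext_coh0.
have [IH1 IH2] := IH _ (shift_res Q) (fun i => pQ i.+1).
have cokernel := coh_zero_cokernel (@ker_incl_inj _ _ _ (res_aug Q))
  (@res_aug_surj _ _ Q) (@ker_incl_exact _ _ _ (res_aug Q)).
have kernel := coh_zero_kernel (@ker_incl_inj _ _ _ (res_aug Q))
  (@res_aug_surj _ _ Q) (@ker_incl_exact _ _ _ (res_aug Q)).
split=> [eQ|cM].
  by apply: cokernel (coh_zero_proj (pQ 0%N)); apply: IH1; apply: eQ.
by apply: IH2; apply: kernel cM; apply: coh_zero_proj.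
Qed.
End Cohomology.

(** * Maximal partial linear maps *)

Section PartialMaps.
Local Open Scope classical_set_scope.
Variables (R : pzRingType) (B I : lmodType R).

(* Graphs of linear maps defined on a submodule of [B]. *)
Definition partial_graph (G : set (B * I)) : Prop :=
  [/\ G 0, forall a x y, G x -> G y -> G (a *: x + y)
    & forall i, G (0, i) -> i = 0].

Lemma partial_graph0 : partial_graph [set 0].
Proof.
split=> // [a x y -> ->|i [//]].
by rewrite scaler0 addr0.
Qed.

Lemma partial_graph_maximal (G0 F : set (B * I)) :
  partial_graph G0 -> G0 `<=` F ->
  exists G, [/\ partial_graph G, G0 `<=` G, G `<=` F
    & forall G', partial_graph G' -> G `<=` G' -> G' `<=` F -> G' `<=` G].
Proof.
move=> pG0 G0F.
pose good G := [/\ partial_graph G, G0 `<=` G & G `<=` F].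
have [|G [[G_0|gG] maxG]] := @Zorn_bigcup (B * I)%type [set G | G = set0 \/ good G].
- move=> C CP Ctot.
  have [[G1 [CG1 gG1]]|noG] := pselect (exists G, C G /\ good G); last first.
    left; apply/seteqP; split=> // x [G CG Gx].
    by case: (CP _ CG) Gx => [->|gG] //; case: noG; exists G.
  have memC G x : C G -> G x -> good G by move=> /CP[->|].
  right; split; first split.
  + by exists G1 => //; case: gG1 => [[]].
  + move=> a x y [Gx CGx Gxx] [Gy CGy Gyy].
    have [sub|sub] := Ctot _ _ CGx CGy.
      exists Gy => //; have [[_ cl _] _ _] := memC _ _ CGy Gyy.
      by apply: cl => //; apply: sub.
    exists Gx => //; have [[_ cl _] _ _] := memC _ _ CGx Gxx.
    by apply: cl => //; apply: sub.
  + by move=> i [G CG Gi]; have [[_ _ fG] _ _] := memC _ _ CG Gi; apply: fG.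
  + by move=> x G0x; exists G1 => //; case: gG1 => _ /(_ x G0x).
  + by move=> x [G CG Gx]; have [_ _ sub] := memC _ _ CG Gx; apply: sub.
- have [G00 _ _] := pG0.
  have lt0 : G `<` G0 by rewrite G_0; split=> [x []|/(_ _ G00)].
  by case: (maxG _ lt0); right; split.
have [pG G0G GF] := gG; exists G; split=> // G' pG' GG' G'F.
apply: contrapT => nG'G; have ltG : G `<` G' by [].
by case: (maxG _ ltG); right; split=> //; apply: subset_trans GG'.
Qed.

Lemma partial_graph_total (G : set (B * I)) :
  partial_graph G -> (forall b, exists i, G (b, i)) ->
  exists g : {linear B -> I}, forall b i, G (b, i) <-> i = g b.
Proof.
move=> [G0 GP Gf] /choice[g gP].
have gE b i : G (b, i) -> i = g b.
  move=> Gbi; apply/eqP; rewrite -subr_eq0; apply/eqP; apply: Gf.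
  have := GP (-1) _ _ (gP b) Gbi.
  by rewrite scaleN1r -[_ + _]/(- b + b, - g b + i) addNr addrC.
have [|g' g'E] := @linear_exists _ B I g.
  by move=> a x y; apply/esym/gE; apply: (GP a (x, g x) (y, g y)).
by exists g' => b i; rewrite g'E; split=> [/gE|->].
Qed.
End PartialMaps.

(** * Linear algebra over a field in arbitrary dimension *)

Section VectorSpaces.
Local Open Scope classical_set_scope.
Variables (K : fieldType).
Implicit Types A B I W : lmodType K.

(* Linear extension and linear lifting at once: [G0] prescribes values and the
   total linear relation [F] constrains them. *)
Lemma vect_extend B I (G0 F : set (B * I)) :
  partial_graph G0 -> G0 `<=` F ->
  (forall a x y, F x -> F y -> F (a *: x + y)) -> (forall b, exists i, F (b, i)) ->
  exists g : {linear B -> I}, (forall b i, G0 (b, i) -> g b = i) /\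
    forall b, F (b, g b).
Proof.
move=> pG0 G0F FP Ftot.
have [G [pG G0G GF maxG]] := partial_graph_maximal pG0 G0F.
have [Gz GP Gf] := pG.
have [b|g gE] := partial_graph_total pG; last first.
  exists g; split=> [b i /G0G/gE -> //|b]; apply: GF; exact/gE.
apply: contrapT => nb; have [i Fbi] := Ftot b.
(* [b] is independent of the domain of [G], so adjoining [(b, i)] keeps the graph single-valued. *)
have bdom k x y : G (x, y) -> x + k *: b = 0 -> k = 0.
  move=> Gxy xkb; apply/eqP; apply/negPn/negP => k0; apply: nb; exists (- k^-1 *: y).
  have := GP (- k^-1) _ _ Gxy Gz; rewrite addr0.
  suff -> : b = - k^-1 *: x by [].
  move/eqP: xkb; rewrite addr_eq0 => /eqP ->.
  by rewrite scalerN scaleNr opprK scalerA mulVf ?scale1r.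
pose G' : set (B * I) := [set z | exists k x y, G (x, y) /\ z = (x + k *: b, y + k *: i)].
apply: nb; exists i; apply: (maxG G'); last first.
- by exists 1, 0, 0; split=> //; rewrite !add0r !scale1r.
- move=> _ [k [x [y [Gxy ->]]]]; have := FP k _ _ Fbi (GF _ Gxy).
  by rewrite -[_ + _]/(_, _) /= addrC [_ + y]addrC.
- by move=> [x y] Gxy; exists 0, x, y; rewrite !scale0r !addr0.
split.
- by exists 0, 0, 0; split=> //; rewrite !scale0r !addr0.
- move=> a _ _ [k [x [y [Gxy ->]]]] [l [z [t [Gzt ->]]]].
  exists (a * k + l), (a *: x + z), (a *: y + t); split; first exact: (GP a (x, y) (z, t)).
  rewrite -[LHS]/(_, _) /=; congr (_, _);
    by rewrite scalerDr scalerDl -scalerA addrACA.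
move=> j [k [x [y [Gxy [x0 ->]]]]]; have k0 := bdom _ _ _ Gxy (esym x0).
move: x0 Gxy; rewrite k0 !scale0r !addr0 => <-; exact: Gf.
Qed.

Lemma vect_section A B (p : {linear A -> B}) : surjective_map p ->
  exists s : {linear B -> A}, forall x, p (s x) = x.
Proof.
move=> sp.
have [|||s [_ sE]] := @vect_extend B A _ [set z | p z.2 = z.1] (@partial_graph0 _ B A).
- by move=> _ -> /=; rewrite linear0.
- by move=> a x y /= px py; rewrite linearP px py.
- by move=> b; have [a] := sp b; exists a.
by exists s.
Qed.

Lemma vect_extension A B I (j : A -> B) (f : A -> I) :
  linear j -> linear f -> (forall x, j x = 0 -> f x = 0) ->
  exists g : {linear B -> I}, forall x, g (j x) = f x.
Proof.
move=> /linear_exists[j' jE] /linear_exists[f' fE] j0.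
pose G0 : set (B * I) := [set z | exists x, z = (j x, f x)].
have pG0 : partial_graph G0.
  split; first by exists 0; rewrite -jE -fE !linear0.
    move=> a _ _ [x ->] [y ->]; exists (a *: x + y).
    by rewrite -!jE -!fE !linearP.
  by move=> i [x [jx ->]]; apply: j0.
have [|||g [gE _]] := @vect_extend B I _ setT pG0; [by []|by []|by move=> b; exists 0|].
by exists g => x; apply: gE; exists x.
Qed.

Lemma vect_separation W (U : set W) (z : W) :
  U 0 -> (forall a x y, U x -> U y -> U (a *: x + y)) -> ~ U z ->
  exists g : {linear W -> K^o}, (forall x, U x -> g x = 0) /\ g z = 1.
Proof.
move=> U0 UP nUz.
(* [G0] is the graph of [u + t z |-> t] on the sum of [U] and the line of [z]. *)
pose G0 : set (W * K^o) := [set t | exists u, U u /\ t.1 = u + t.2 *: z].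
have pG0 : partial_graph G0.
  split; first by exists 0; split=> //; rewrite scale0r addr0.
    move=> a [x1 x2] [y1 y2] [u [Uu /= ->]] [v [Uv /= ->]].
    exists (a *: u + v); split; first exact: UP.
    by rewrite /= scalerDr scalerDl -scalerA addrACA.
  move=> i [u [Uu /= /esym/eqP]]; rewrite addrC addr_eq0 => /eqP E; apply: contrapT.
  move/eqP => i0; apply: nUz; have := UP (- i^-1) u 0 Uu U0.
  by rewrite addr0 scaleNr -scalerN -E scalerA mulVf // scale1r.
have [|||g [gE _]] := @vect_extend W K^o _ setT pG0; [by []|by []|by move=> b; exists 0|].
exists g; split=> [x Ux|]; apply: gE; last by exists 0; rewrite add0r scale1r.
by exists x; rewrite scale0r addr0.
Qed.
End VectorSpaces.

(** * Finite-dimensional algebras *)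

(** The algebra structure is explicit data, so that an algebra and its opposite can share basis and
    coordinates. *)
Record fdalg (K : fieldType) (m : nat) (R : pzRingType) := Fdalg {
  emb : K -> R;
  bas : 'I_m -> R;
  crd : 'I_m -> R -> K;
  emb1 : emb 1 = 1;
  embD : forall a b, emb (a + b) = emb a + emb b;
  embM : forall a b, emb (a * b) = emb a * emb b;
  emb_comm : forall a r, emb a * r = r * emb a;
  crdP : forall i a r s, crd i (emb a * r + s) = a * crd i r + crd i s;
  crd_bas : forall i j, crd i (bas j) = (i == j)%:R;
  bas_crd : forall r, r = \sum_i emb (crd i r) * bas i }.

Section Algebra.
Variables (K : fieldType) (m : nat) (R : pzRingType) (A : fdalg K m R).

Lemma crdD i r s : crd A i (r + s) = crd A i r + crd A i s.
Proof. by rewrite -[r in LHS]mul1r -(emb1 A) crdP mul1r. Qed.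

Lemma crd0 i : crd A i 0 = 0.
Proof. by apply: (addrI (crd A i 0)); rewrite -crdD !addr0. Qed.

Lemma crdZ i a r : crd A i (emb A a * r) = a * crd A i r.
Proof. by rewrite -[_ * r]addr0 crdP crd0 addr0. Qed.

Lemma crd_sum i (I : Type) (s : seq I) (F : I -> R) :
  crd A i (\sum_(j <- s) F j) = \sum_(j <- s) crd A i (F j).
Proof. exact: (big_morph _ (@crdD i) (crd0 i)). Qed.

Lemma crd_emb_bas a i j : crd A i (emb A a * bas A j) = a * (i == j)%:R.
Proof. by rewrite crdZ crd_bas. Qed.

(** Restriction of scalars to [K]; the argument [A] is there because the action of [K] depends on
    it. *)
Definition kmod (_ : fdalg K m R) (M : lmodType R) : Type := M.
Section Kmod.
Variable M : lmodType R.
HB.instance Definition _ := GRing.Zmodule.on (kmod A M).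
Let kscale (a : K) (x : kmod A M) : kmod A M := emb A a *: (x : M).
Let kscaleA a b x : kscale a (kscale b x) = kscale (a * b) x.
Proof. by rewrite /kscale scalerA embM. Qed.
Let kscale1 : left_id 1 kscale.
Proof. by move=> x; rewrite /kscale emb1 scale1r. Qed.
Let kscaleDr : right_distributive kscale +%R.
Proof. by move=> a x y; rewrite /kscale scalerDr. Qed.
Let kscaleDl x : {morph kscale^~ x : a b / a + b}.
Proof. by move=> a b; rewrite /kscale embD scalerDl. Qed.
HB.instance Definition _ := GRing.Zmodule_isLmodule.Build K (kmod A M)
  kscaleA kscale1 kscaleDr kscaleDl.

Lemma kmodE (a : K) (x : M) : a *: (x : kmod A M) = emb A a *: x.
Proof. by []. Qed.
End Kmod.

Lemma klinear (M N : lmodType R) (f : {linear M -> N}) :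
  linear (f : kmod A M -> kmod A N).
Proof. by move=> a x y; rewrite !kmodE linearP. Qed.

Definition mxrep (rho : R -> 'M[K]_m) := [/\ rho 1 = 1%:M,
  forall a b, rho (a * b) = rho a *m rho b & forall a b, rho (a + b) = rho a + rho b].

(** The tensor product [K^m (x) W], with [R] acting on [K^m] through [rho]. *)
Definition twist (rho : R -> 'M[K]_m) of mxrep rho := fun W : lmodType K =>
  {ffun 'I_m -> W}.

Section Twist.
Variables (rho : R -> 'M[K]_m) (rhoP : mxrep rho) (W : lmodType K).
Local Notation T := (twist rhoP W).
HB.instance Definition _ := GRing.Zmodule.on T.

Let tscale (a : R) (v : T) : T := [ffun i => \sum_j rho a i j *: (v : {ffun 'I_m -> W}) j].
Let tscaleA a b v : tscale a (tscale b v) = tscale (a * b) v.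
Proof.
have [_ rhoM _] := rhoP; apply/ffunP => i; rewrite !ffunE.
under eq_bigr do rewrite ffunE scaler_sumr.
rewrite exchange_big /=; apply: eq_bigr => j _; rewrite rhoM mxE scaler_suml.
by apply: eq_bigr => k _; rewrite scalerA.
Qed.
Let tscale1 : left_id 1 tscale.
Proof.
have [rho1 _ _] := rhoP; move=> v; apply/ffunP => i; rewrite ffunE (bigD1 i) //=.
rewrite rho1 mxE eqxx scale1r big1 ?addr0 // => j ji.
by rewrite mxE eq_sym (negPf ji) scale0r.
Qed.
Let tscaleDr : right_distributive tscale +%R.
Proof.
move=> a u v; apply/ffunP => i; rewrite !ffunE -big_split /=.
by apply: eq_bigr => j _; rewrite ffunE scalerDr.
Qed.
Let tscaleDl v : {morph tscale^~ v : a b / a + b}.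
Proof.
have [_ _ rhoD] := rhoP; move=> a b; apply/ffunP => i; rewrite !ffunE -big_split /=.
by apply: eq_bigr => j _; rewrite rhoD mxE scalerDl.
Qed.
HB.instance Definition _ := GRing.Zmodule_isLmodule.Build R T
  tscaleA tscale1 tscaleDr tscaleDl.

Lemma twistE (a : R) (v : T) i :
  (a *: v : {ffun 'I_m -> W}) i = \sum_j rho a i j *: (v : {ffun 'I_m -> W}) j.
Proof. by rewrite ffunE. Qed.
End Twist.

(** The twist of [W] by [rho_l] is the free module [R (x) W]; by [rho_r] it is the cofree module
    [Hom_K(R, W)], a map being recorded by its values on the basis. *)
Definition rho_l a : 'M[K]_m := \matrix_(i, j) crd A i (a * bas A j).
Definition rho_r a : 'M[K]_m := \matrix_(i, j) crd A j (bas A i * a).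

Lemma rho_lP : mxrep rho_l.
Proof.
split=> [|a b|a b]; apply/matrixP => i j; rewrite !mxE.
- by rewrite mul1r crd_bas.
- rewrite -mulrA {1}(bas_crd A (b * bas A j)) mulr_sumr crd_sum.
  apply: eq_bigr => k _; rewrite !mxE mulrA -emb_comm -mulrA crdZ; exact: mulrC.
- by rewrite mulrDl crdD.
Qed.

Lemma rho_rP : mxrep rho_r.
Proof.
split=> [|a b|a b]; apply/matrixP => i j; rewrite !mxE.
- by rewrite mulr1 crd_bas eq_sym.
- rewrite mulrA {1}(bas_crd A (bas A i * a)) mulr_suml crd_sum.
  by apply: eq_bigr => k _; rewrite !mxE -mulrA crdZ.
- by rewrite mulrDr crdD.
Qed.

(* Writing the free module on the vector space [P] as [P^m], these are the
   coordinates of an [R]-linear section of the multiplication map onto [P]. *)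
Definition proj_splitting (P : lmodType R) (sg : 'I_m -> {linear kmod A P -> kmod A P}) :=
  (forall x : P, \sum_i bas A i *: (sg i x : P) = x) /\
  forall a (x : P) i, sg i (a *: x) = \sum_j crd A i (a * bas A j) *: sg j x.

(* Dually, the components of an [R]-linear retraction of the embedding of [I]
   into the cofree module [Hom_K(R, I)]. *)
Definition inj_splitting (I : lmodType R) (tau : 'I_m -> {linear kmod A I -> kmod A I}) :=
  (forall x : I, \sum_i tau i (bas A i *: x) = x) /\
  forall a (y : I) j, a *: (tau j y : I) = \sum_i crd A j (bas A i * a) *: tau i y.

(** [g] is the composite [P -> R (x) P -> R (x) B -> B] of the section, [1 (x) u] and
    multiplication, which is [R]-linear although [u] is only [K]-linear. *)
Lemma proj_splitting_average (P B : lmodType R) sg (u : {linear kmod A P -> kmod A B}) :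
  @proj_splitting P sg ->
  exists g : {linear P -> B}, forall x, g x = \sum_i bas A i *: (u (sg i x) : B).
Proof.
case=> _ sgM; apply: linear_exists => a x y; rewrite scaler_sumr.
rewrite (eq_bigr (fun i => bas A i *: (u (sg i (a *: x)) : B)
  + bas A i *: (u (sg i y) : B))); last first.
  by move=> i _; rewrite -scalerDr (linearD (sg i)) (linearD u).
rewrite big_split /=; congr (_ + _).
have E i : u (sg i (a *: x)) = \sum_j emb A (crd A i (a * bas A j)) *: (u (sg j x) : B).
  by rewrite sgM linear_sum; apply: eq_bigr => j _; rewrite linearZ.
rewrite (eq_bigr (fun i => \sum_j (emb A (crd A i (a * bas A j)) * bas A i) *:
    (u (sg j x) : B))); last first.
  by move=> i _; rewrite E scaler_sumr; apply: eq_bigr => j _; rewrite scalerA emb_comm.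
rewrite exchange_big /=; apply: eq_bigr => j _.
by rewrite -scaler_suml -bas_crd scalerA.
Qed.

Lemma proj_splitting_projective P sg : @proj_splitting P sg -> projective_mod P.
Proof.
move=> sgP B C p f sp.
have [p' p'E] := linear_exists (klinear p).
have [f' f'E] := linear_exists (klinear f).
have [s sE] : exists s : {linear kmod A C -> kmod A B}, forall x, p' (s x) = x.
  by apply: vect_section => y; have [x <-] := sp y; exists x; rewrite p'E.
have [g gE] := proj_splitting_average (s \o f') sgP.
exists g => x; have [sg1 _] := sgP; rewrite gE linear_sum -[in RHS](sg1 x) linear_sum.
by apply: eq_bigr => i _; rewrite !linearZ /= -p'E sE f'E.
Qed.

Lemma inj_splitting_injective I tau : @inj_splitting I tau -> injective_mod I.
Proof.
case=> tau1 tauM B C j f ij.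
have [|F FE] := @vect_extension K (kmod A B) (kmod A C) (kmod A I) j f (klinear j) (klinear f).
  move=> x jx; have -> : x = 0 :> B by apply: ij; rewrite (linear0 j).
  exact: (linear0 f).
(* The extension is [x |-> (r |-> F (r x))], with values in [Hom_K(R, I)], followed by the
   retraction with components [tau]. *)
have [|g gE] := @linear_exists _ C I
    (fun x => \sum_i tau i (F (bas A i *: x))); last first.
  exists g => x; rewrite gE -[RHS]tau1; apply: eq_bigr => i _.
  by rewrite -!linearZ /= FE.
move=> a x y; rewrite scaler_sumr -big_split /=.
rewrite (eq_bigr (fun i => tau i (F (bas A i *: (a *: x))) + tau i (F (bas A i *: y)))); last first.
  by move=> i _; rewrite scalerDr (linearD F) (linearD (tau i)).
rewrite !big_split /=; congr (_ + _).
have E i : tau i (F (bas A i *: (a *: x))) =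
    \sum_j crd A j (bas A i * a) *: tau i (F (bas A j *: x)).
  rewrite scalerA {1}(bas_crd A (bas A i * a)) scaler_suml.
  rewrite (linear_sum F) (linear_sum (tau i)); apply: eq_bigr => k _.
  by rewrite -scalerA -!linearZ.
rewrite (eq_bigr _ (fun i _ => E i)) exchange_big /=; apply: eq_bigr => k _.
by rewrite tauM.
Qed.
End Algebra.

(** * Free and cofree modules, enough projectives *)

Section EnoughProjectives.
Variables (K : fieldType) (m : nat) (R : pzRingType) (A : fdalg K m R).
Implicit Types M N P I : lmodType R.

Lemma rho_l_emb a : rho_l A (emb A a) = a%:M.
Proof. by apply/matrixP => i j; rewrite !mxE crd_emb_bas mulr_natr. Qed.

Lemma rho_r_emb a : rho_r A (emb A a) = a%:M.
Proof.
by apply/matrixP => i j; rewrite !mxE -emb_comm crd_emb_bas mulr_natr eq_sym.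
Qed.

Lemma twist_emb rho (rhoP : mxrep rho) (W : lmodType K) a (v : twist rhoP W) i :
  rho (emb A a) = a%:M ->
  (emb A a *: v : {ffun 'I_m -> W}) i = a *: (v : {ffun 'I_m -> W}) i.
Proof.
move=> rhoa; rewrite twistE rhoa (bigD1 i) //= mxE eqxx big1 ?addr0 // => j ji.
by rewrite mxE eq_sym (negPf ji) scale0r.
Qed.

Definition free_on M : lmodType R := twist (rho_lP A) (kmod A M).

Definition free_map M (v : free_on M) : M :=
  \sum_i bas A i *: ((v : {ffun 'I_m -> kmod A M}) i : M).

Lemma free_mapP M : linear (@free_map M).
Proof.
move=> a u v; rewrite /free_map scaler_sumr -!big_split /=.
rewrite (eq_bigr (fun i => bas A i *: (((a *: u : free_on M) : {ffun 'I_m -> kmod A M}) i : M)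
  + bas A i *: ((v : {ffun 'I_m -> kmod A M}) i : M))); last first.
  by move=> i _; rewrite -scalerDr ffunE.
rewrite big_split /= [RHS]big_split /=; congr (_ + _).
under eq_bigr => i _ do rewrite twistE scaler_sumr.
rewrite exchange_big /=; apply: eq_bigr => j _.
rewrite scalerA [in RHS](bas_crd A (a * bas A j)) scaler_suml; apply: eq_bigr => i _.
by rewrite mxE kmodE scalerA emb_comm.
Qed.
HB.instance Definition _ M := GRing.isLinear.Build R (free_on M) M _
  (@free_map M) (@free_mapP M).

Definition free_unit M (x : M) : free_on M :=
  [ffun i => crd A i 1 *: (x : kmod A M)] : {ffun 'I_m -> kmod A M}.

Lemma free_map_unit M (x : M) : free_map (free_unit x) = x.
Proof.
rewrite /free_map -[RHS]scale1r [in RHS](bas_crd A 1) scaler_suml.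
by apply: eq_bigr => i _; rewrite ffunE kmodE scalerA emb_comm.
Qed.

Lemma free_map_surj M : surjective_map (@free_map M).
Proof. by move=> x; exists (free_unit x); rewrite free_map_unit. Qed.

Lemma free_proj_splitting M : exists sg, @proj_splitting _ _ _ A (free_on M) sg.
Proof.
(* The component [sg i] sends [v] to [1 (x) v_i]. *)
have lin i : linear (fun v : kmod A (free_on M) =>
    free_unit ((v : {ffun 'I_m -> kmod A M}) i) : kmod A (free_on M)).
  move=> a u v; apply/ffunP => k; rewrite [RHS]ffunE kmodE twist_emb ?rho_l_emb //.
  rewrite [LHS]ffunE [X in _ *: X]ffunE twist_emb ?rho_l_emb // !ffunE scalerDr.
  by congr (_ + _); rewrite !scalerA mulrC.
have /choice[sg sgE] := fun i => linear_exists (lin i).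
exists sg; split=> [v|a v i].
  apply/ffunP => k; rewrite sum_ffunE.
  under eq_bigr => i _ do rewrite sgE twistE.
  have E i : \sum_j crd A k (bas A i * bas A j) * crd A j 1 = (k == i)%:R.
    rewrite -(crd_bas A) -[bas A i in RHS]mulr1 [in RHS](bas_crd A 1) mulr_sumr crd_sum.
    by apply: eq_bigr => j _; rewrite mulrA -emb_comm -mulrA crdZ mulrC.
  have Ev i : \sum_j rho_l A (bas A i) k j *:
      (free_unit ((v : {ffun 'I_m -> kmod A M}) i) : {ffun 'I_m -> kmod A M}) j
      = (k == i)%:R *: (v : {ffun 'I_m -> kmod A M}) i.
    by rewrite -E scaler_suml; apply: eq_bigr => j _; rewrite mxE ffunE scalerA.
  under eq_bigr => i _ do rewrite Ev.
  rewrite (bigD1 k) //= eqxx scale1r big1 ?addr0 // => i ik.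
  by rewrite eq_sym (negPf ik) scale0r.
rewrite sgE; under eq_bigr => j _ do rewrite sgE.
apply/ffunP => k; rewrite sum_ffunE ffunE twistE scaler_sumr; apply: eq_bigr => j _.
by rewrite kmodE twist_emb ?rho_l_emb // mxE ffunE !scalerA mulrC -embM.
Qed.

Lemma free_projective M : projective_mod (free_on M).
Proof. by have [sg sgP] := free_proj_splitting M; apply: proj_splitting_projective sgP. Qed.

Lemma projective_proj_splitting P : projective_mod P ->
  exists sg, @proj_splitting _ _ _ A P sg.
Proof.
move=> pP; have [s sK] := pP _ _ (@free_map P) idfun (@free_map_surj P).
have lin i : linear (fun x : kmod A P => (s x : {ffun 'I_m -> kmod A P}) i).
  by move=> a x y; rewrite kmodE linearP ffunE twist_emb ?rho_l_emb.
have /choice[sg sgE] := fun i => linear_exists (lin i).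
exists sg; split=> [x|a x i].
  by under eq_bigr => i _ do rewrite sgE; apply: sK.
rewrite sgE linearZ twistE; apply: eq_bigr => j _.
by rewrite mxE sgE.
Qed.

(** Injectivity gives a retraction [t] of the embedding [x |-> (r |-> r x)] into the cofree module;
    the [tau i] are its restrictions to the coordinates. *)
Lemma injective_inj_splitting I : injective_mod I ->
  exists tau, @inj_splitting _ _ _ A I tau.
Proof.
move=> injI.
pose T : lmodType R := twist (rho_rP A) (kmod A I).
have lin : linear (fun x : I => [ffun i => bas A i *: x] : T).
  move=> a x y; apply/ffunP => i; rewrite ffunE [RHS]ffunE twistE ffunE scalerDr.
  congr (_ + _); rewrite scalerA {1}(bas_crd A (bas A i * a)) scaler_suml.
  by apply: eq_bigr => j _; rewrite mxE ffunE kmodE scalerA.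
have [j jE] := linear_exists lin.
have [|t tK] := injI _ _ j idfun.
  move=> x y E; rewrite -[x]scale1r -[y]scale1r (bas_crd A 1) !scaler_suml.
  apply: eq_bigr => i _; rewrite -!scalerA; congr (_ *: _).
  move: E; rewrite !jE => /ffunP/(_ i); by rewrite !ffunE.
pose d i (y : I) : T := [ffun k => if k == i then (y : kmod A I) else 0] : {ffun 'I_m -> kmod A I}.
have dE i a y : d i (emb A a *: y) = emb A a *: d i y.
  apply/ffunP => k; rewrite twist_emb ?rho_r_emb // !ffunE.
  by case: (k == i); rewrite ?scaler0.
have dD i x y : d i (x + y) = d i x + d i y.
  by apply/ffunP => k; rewrite !ffunE; case: (k == i); rewrite ?addr0.
have lint i : linear (fun y : kmod A I => t (d i y) : kmod A I).
  by move=> a x y; rewrite dD dE linearP.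
have /choice[tau tauE] := fun i => linear_exists (lint i).
exists tau; split=> [x|a y k].
  under eq_bigr => i _ do rewrite tauE.
  rewrite -linear_sum -[RHS]tK; congr (t _); rewrite jE; apply/ffunP => k.
  rewrite sum_ffunE ffunE (bigD1 k) //= ffunE eqxx big1 ?addr0 // => i ik.
  by rewrite ffunE eq_sym (negPf ik).
rewrite tauE -linearZ; under eq_bigr => i _ do rewrite tauE kmodE -linearZ /= -dE.
rewrite -linear_sum; congr (t _); apply/ffunP => i.
rewrite twistE sum_ffunE (bigD1 k) //= [X in _ + X]big1 ?addr0 => [|l lk]; last first.
  by rewrite ffunE (negPf lk) scaler0.
rewrite (bigD1 i) //= [X in _ = _ + X]big1 ?addr0 => [|l li]; last first.
  by rewrite ffunE eq_sym (negPf li).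
by rewrite mxE !ffunE !eqxx kmodE.
Qed.

(** Kernels of multiplication maps rather than of projective covers, so these syzygies need not be
    minimal. *)
Fixpoint syz M n : lmodType R :=
  if n is k.+1 then kermod (@free_map (syz M k)) else M.

Lemma projective_resolution M : exists Q : resolution M, forall i, projective_mod (Q i).
Proof.
pose d n : {linear free_on (syz M n.+1) -> free_on (syz M n)} :=
  ker_incl (@free_map (syz M n)) \o @free_map (syz M n.+1).
have aug_ex n : exact_at (d n) (@free_map (syz M n)).
  move=> y; rewrite (@ker_incl_exact _ _ _ (@free_map (syz M n))).
  split=> [[x <-]|[x <-]]; last by eexists.
  by have [z <-] := free_map_surj x; exists z.
have dd_ex n : exact_at (d n.+1) (d n).
  move=> y; rewrite -aug_ex; split=> E; last first.
    exact: etrans (congr1 (ker_incl (@free_map (syz M n))) E) (linear0 _).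
  by apply: (@ker_incl_inj _ _ _ (@free_map (syz M n))); rewrite linear0.
exists (@Resolution R M (fun n => free_on (syz M n)) d (@free_map M)
  (@free_map_surj M) (aug_ex 0%N) dd_ex).
by move=> i; apply: free_projective.
Qed.
End EnoughProjectives.

(** * The duality Hom_K(-, K) *)

(** Keeping two rings and a map between them lets the duality be applied in both directions. *)
Record anti_iso (K : fieldType) (m : nat) (R R' : pzRingType)
    (A : fdalg K m R) (A' : fdalg K m R') := AntiIso {
  anti :> R' -> R;
  anti1 : anti 1 = 1;
  antiD : forall a b, anti (a + b) = anti a + anti b;
  antiM : forall a b, anti (a * b) = anti b * anti a;
  anti_emb : forall k, anti (emb A' k) = emb A k;
  anti_bas : forall i, anti (bas A' i) = bas A i;
  anti_crd : forall i r, crd A' i r = crd A i (anti r) }.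

Section Dual.
Variables (K : fieldType) (m : nat) (R R' : pzRingType).
Variables (A : fdalg K m R) (A' : fdalg K m R') (T : anti_iso A A').
Implicit Types M N L : lmodType R.

(** [T] is a parameter of the type because the action of [R'], [(a f) x = f (T a x)], is defined
    through it. *)
Record dual (T : anti_iso A A') (M : lmodType R) : Type := Dual {
  dfun :> M -> K;
  dfunP : forall k x y, dfun (emb A k *: x + y) = k * dfun x + dfun y }.

Lemma dual_ext M (f g : dual T M) : f =1 g -> f = g.
Proof.
case: f g => [f fP] [g gP] /= /funext E; subst g; congr Dual; exact: Prop_irrelevance.
Qed.

HB.instance Definition _ M := gen_eqMixin (dual T M).
HB.instance Definition _ M := gen_choiceMixin (dual T M).

Section DualModule.
Variable M : lmodType R.
Implicit Types f g : dual T M.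

Let daddP f g k x y : f (emb A k *: x + y) + g (emb A k *: x + y)
  = k * (f x + g x) + (f y + g y).
Proof. by rewrite !dfunP mulrDr addrACA. Qed.
Let dadd f g := Dual T (daddP f g).

Let doppP f k x y : - f (emb A k *: x + y) = k * (- f x) + - f y.
Proof. by rewrite dfunP opprD mulrN. Qed.
Let dopp f := Dual T (doppP f).

Let dzeroP k (x y : M) : 0 = k * 0 + 0 :> K.
Proof. by rewrite mulr0 addr0. Qed.
Let dzero := Dual T dzeroP.

Let dscaleP (a : R') f k x y :
  f (T a *: (emb A k *: x + y)) = k * f (T a *: x) + f (T a *: y).
Proof. by rewrite scalerDr scalerA -emb_comm -scalerA dfunP. Qed.
Let dscale a f := Dual T (dscaleP a f).

Let daddA : associative dadd.
Proof. by move=> f g h; apply: dual_ext => x /=; rewrite addrA. Qed.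
Let daddC : commutative dadd.
Proof. by move=> f g; apply: dual_ext => x /=; rewrite addrC. Qed.
Let dadd0 : left_id dzero dadd.
Proof. by move=> f; apply: dual_ext => x /=; rewrite add0r. Qed.
Let daddN : left_inverse dzero dopp dadd.
Proof. by move=> f; apply: dual_ext => x /=; rewrite addNr. Qed.
HB.instance Definition _ := GRing.isZmodule.Build (dual T M) daddA daddC dadd0 daddN.

Lemma dfunD f x y : f (x + y) = f x + f y.
Proof. by rewrite -[x in LHS]scale1r -(emb1 A) dfunP mul1r. Qed.
Lemma dfun0 f : f 0 = 0.
Proof. by apply: (addrI (f 0)); rewrite -dfunD !addr0. Qed.
Lemma dfunZ f k x : f (emb A k *: x) = k * f x.
Proof. by rewrite -[_ *: x]addr0 dfunP dfun0 addr0. Qed.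
Lemma dfun_sum f (I : Type) (s : seq I) (F : I -> M) :
  f (\sum_(j <- s) F j) = \sum_(j <- s) f (F j).
Proof. exact: (big_morph _ (@dfunD f) (dfun0 f)). Qed.

Let dscaleA a b f : dscale a (dscale b f) = dscale (a * b) f.
Proof. by apply: dual_ext => x /=; rewrite scalerA antiM. Qed.
Let dscale1 : left_id 1 dscale.
Proof. by move=> f; apply: dual_ext => x /=; rewrite anti1 scale1r. Qed.
Let dscaleDr : right_distributive dscale +%R.
Proof. by move=> a f g; apply: dual_ext. Qed.
Let dscaleDl f : {morph dscale^~ f : a b / a + b}.
Proof. by move=> a b; apply: dual_ext => x /=; rewrite antiD scalerDl dfunD. Qed.
HB.instance Definition _ := GRing.Zmodule_isLmodule.Build R' (dual T M)
  dscaleA dscale1 dscaleDr dscaleDl.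

Lemma dualDE f g x : (f + g) x = f x + g x. Proof. by []. Qed.
Lemma dual0E x : (0 : dual T M) x = 0. Proof. by []. Qed.
Lemma dualZE (a : R') f x : (a *: f) x = f (T a *: x). Proof. by []. Qed.
Lemma dual_sumE (I : Type) (s : seq I) (F : I -> dual T M) x :
  (\sum_(j <- s) F j) x = \sum_(j <- s) F j x.
Proof. exact: (big_morph (fun f : dual T M => f x)). Qed.
Lemma dual_kscaleE k f x : (emb A' k *: f) x = k * f x.
Proof. by rewrite dualZE anti_emb dfunZ. Qed.

Lemma dual_linear f : linear (f : kmod A M -> K^o).
Proof. by move=> k x y; rewrite dfunP. Qed.

Lemma linear_dual (g : {linear kmod A M -> K^o}) : exists f : dual T M, forall x, f x = g x.
Proof.
have gP k (x y : M) : g (emb A k *: x + y) = k * g x + g y by exact: linearP.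
by exists (Dual T gP).
Qed.
End DualModule.

Section DualMap.
Variables (M N : lmodType R) (h : {linear M -> N}).
Let dmapP (f : dual T N) k x y :
  f (h (emb A k *: x + y)) = k * f (h x) + f (h y).
Proof. by rewrite linearP dfunP. Qed.
Definition dmap (f : dual T N) : dual T M := Dual T (dmapP f).
Let dmap_linear : linear dmap.
Proof. by move=> a f g; apply: dual_ext => x /=; rewrite linearZ. Qed.
HB.instance Definition _ := GRing.isLinear.Build R' (dual T N) (dual T M) _
  dmap dmap_linear.
Lemma dmapE f x : dmap f x = f (h x). Proof. by []. Qed.
End DualMap.

(** A functional vanishing on the image of [f] vanishes on the kernel of [g], so it factors through
    the image of [g] and extends to [L]. *)
Lemma dmap_exact M N L (f : {linear M -> N}) (g : {linear N -> L}) :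
  exact_at f g -> exact_at (dmap g) (dmap f).
Proof.
move=> ex a; split=> [af|[b <-]]; last first.
  apply: dual_ext => x; rewrite !dmapE; have -> : g (f x) = 0 by apply/ex; exists x.
  exact: dfun0.
have [|b bE] := vect_extension (klinear (A := A) g) (dual_linear a).
  by move=> x /(ex x).1[y <-]; have /(congr1 (fun t : dual T M => t y)) := af.
have [b' b'E] := linear_dual b.
by exists b'; apply: dual_ext => x; rewrite dmapE b'E bE.
Qed.

Lemma dmap_inj M N (f : {linear M -> N}) : surjective_map f -> injective (dmap f).
Proof.
move=> sf a b E; apply: dual_ext => y; have [x <-] := sf y.
by have /(congr1 (fun t : dual T M => t x)) := E.
Qed.

Lemma dmap_surj M N (f : {linear M -> N}) : injective f -> surjective_map (dmap f).
Proof.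
move=> fi a; have [|b bE] := vect_extension (klinear (A := A) f) (dual_linear a).
  move=> x fx; have -> : x = 0 :> M by apply: fi; rewrite (linear0 f).
  exact: dfun0.
have [b' b'E] := linear_dual b.
by exists b'; apply: dual_ext => x; rewrite dmapE b'E bE.
Qed.

Definition dual_cores M (Q : resolution M) : coresolution (dual T M) :=
  @Coresolution R' (dual T M) (fun i => dual T (Q i)) (fun i => dmap (res_diff Q i))
    (dmap (res_aug Q)) (dmap_inj (@res_aug_surj _ _ Q))
    (dmap_exact (@res_aug_exact _ _ Q))
    (fun i => dmap_exact (@res_diff_exact _ _ Q i)).

Definition dual_res M (I : coresolution M) : resolution (dual T M) :=
  @Resolution R' (dual T M) (fun i => dual T (I i)) (fun i => dmap (cores_diff I i))
    (dmap (cores_aug I)) (dmap_surj (@cores_aug_inj _ _ I))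
    (dmap_exact (@cores_aug_exact _ _ I))
    (fun i => dmap_exact (@cores_diff_exact _ _ I i)).

Lemma dual_zero M : zero_mod M -> zero_mod (dual T M).
Proof. by move=> zM f; apply: dual_ext => x; rewrite (zM x) !dfun0. Qed.

Lemma dual_length n (C : nat -> lmodType R) :
  length_le n C -> length_le n (fun i => dual T (C i)).
Proof. by move=> lC i /lC/dual_zero. Qed.

Section Transpose.
Variables (M : lmodType R) (g : {linear kmod A M -> kmod A M}).
Let transposeP (f : dual T M) k (x y : M) :
  f (g (emb A k *: x + y)) = k * f (g x) + f (g y).
Proof.
by have -> : g (emb A k *: x + y) = emb A k *: (g x : M) + g y;
  [exact: linearP | rewrite dfunP].
Qed.
Definition transpose (f : kmod A' (dual T M)) : kmod A' (dual T M) :=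
  Dual T (transposeP f).
Let transpose_linear : linear transpose.
Proof.
by move=> k f h; apply: dual_ext => x; rewrite !kmodE [LHS]dualDE [RHS]dualDE !dual_kscaleE.
Qed.
HB.instance Definition _ := GRing.isLinear.Build K (kmod A' (dual T M))
  (kmod A' (dual T M)) _ transpose transpose_linear.
End Transpose.

(** [T] reverses products, so the coordinates of [a * b_j] in [A] become those of [b_j * a] in [A'],
    as the identities for a retraction require. *)
Lemma dual_proj_splitting M sg : @proj_splitting _ _ _ A M sg ->
  @inj_splitting _ _ _ A' (dual T M) (fun i => transpose (sg i)).
Proof.
move=> [sg1 sgM]; split=> [f|a f j]; apply: dual_ext => x.
  rewrite dual_sumE -[in RHS](sg1 x) dfun_sum; apply: eq_bigr => i _.
  by rewrite /= anti_bas.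
rewrite dualZE /= sgM dfun_sum dual_sumE; apply: eq_bigr => i _.
by rewrite kmodE dfunZ kmodE dual_kscaleE (anti_crd T) antiM anti_bas.
Qed.

Lemma dual_inj_splitting M tau : @inj_splitting _ _ _ A M tau ->
  @proj_splitting _ _ _ A' (dual T M) (fun i => transpose (tau i)).
Proof.
move=> [tau1 tauM]; split=> [f|a f i]; apply: dual_ext => x.
  rewrite dual_sumE -[in RHS](tau1 x) dfun_sum; apply: eq_bigr => i _.
  by rewrite dualZE /= anti_bas.
rewrite /= tauM dfun_sum dual_sumE; apply: eq_bigr => j _.
by rewrite kmodE dfunZ kmodE dual_kscaleE (anti_crd T) antiM anti_bas.
Qed.

Lemma dual_projective M : projective_mod M -> injective_mod (dual T M).
Proof.
case/(projective_proj_splitting A) => sg /dual_proj_splitting.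
exact: inj_splitting_injective.
Qed.

Lemma dual_injective M : injective_mod M -> projective_mod (dual T M).
Proof.
case/(injective_inj_splitting A) => tau /dual_inj_splitting.
exact: proj_splitting_projective.
Qed.
End Dual.

(** * Lifting from simple modules *)

Section SimpleLift.
Variables (K : fieldType) (m : nat) (R : pzRingType) (A : fdalg K m R).

(** Acting on row vectors, this is right multiplication by [c]: its row space is the left ideal
    [R c] and its rank the dimension of that ideal. *)
Definition right_mulmx c : 'M[K]_m := \matrix_(i, j) crd A j (bas A i * c).
Definition crdv r : 'rV[K]_m := \row_j crd A j r.

Lemma crdvM r c : crdv (r * c) = crdv r *m right_mulmx c.
Proof.
apply/rowP => j; rewrite !mxE {1}(bas_crd A r) mulr_suml crd_sum.
by apply: eq_bigr => i _; rewrite !mxE -mulrA crdZ.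
Qed.

Lemma crdv_inj : injective crdv.
Proof.
move=> r s /rowP E; rewrite (bas_crd A r) (bas_crd A s); apply: eq_bigr => i _.
by have := E i; rewrite !mxE => ->.
Qed.

Lemma crdv_onto v : exists r, crdv r = v.
Proof.
exists (\sum_i emb A (v 0 i) * bas A i); apply/rowP => j; rewrite mxE crd_sum.
rewrite (bigD1 j) //= crd_emb_bas eqxx mulr1 big1 ?addr0 // => i ij.
by rewrite crd_emb_bas eq_sym (negPf ij) mulr0.
Qed.

Lemma right_mulmxM a c : right_mulmx (a * c) = right_mulmx a *m right_mulmx c.
Proof.
apply/row_matrixP => i; rewrite row_mul.
have rowE b : row i (right_mulmx b) = crdv (bas A i * b) by apply/rowP => j; rewrite !mxE.
by rewrite !rowE mulrA crdvM.
Qed.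

(* Among the nonzero multiples of a vector in a quotient, one generating a
   left ideal of least dimension generates a simple submodule. *)
Lemma simple_multiple (U : R -> Prop) : ~ U 1 ->
  exists c, ~ U c /\ forall a, ~ U (a * c) -> exists b, b * (a * c) = c.
Proof.
move=> U1.
have exn : exists n, `[< exists2 c, ~ U c & \rank (right_mulmx c) = n >].
  by exists (\rank (right_mulmx 1)); apply/asboolP; exists 1.
case: (ex_minnP exn) => n /asboolP[c Uc rkc] minn.
exists c; split=> // a Uac.
have le_ac : (right_mulmx (a * c) <= right_mulmx c)%MS by rewrite right_mulmxM submxMl.
(* By minimality [R a c] has the dimension of [R c], so the two left ideals coincide. *)
have : (right_mulmx c <= right_mulmx (a * c))%MS.
  rewrite -(mxrank_leqif_sup le_ac) eqn_leq (mxrankS le_ac) /= rkc.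
  by apply: minn; apply/asboolP; exists (a * c).
have := crdvM 1 c; rewrite mul1r => cE.
move=> /(submx_trans (submxMl (crdv 1) _)); rewrite -cE => /submxP[v vE].
have [b bE] := crdv_onto v; exists b.
by apply: crdv_inj; rewrite crdvM bE.
Qed.

(** A maximal partial lift is total: otherwise some [b1] outside its domain generates a simple
    module modulo the domain, and lifting a map from that module extends the partial lift to
    [b1]. *)
Lemma simple_lift (I I2 B : lmodType R) (p : {linear I -> I2}) (f : {linear B -> I2}) :
  injective_mod I ->
  (forall S, simple_mod S -> forall u : {linear S -> I2},
     exists v : {linear S -> I}, forall x, p (v x) = u x) ->
  exists g : {linear B -> I}, forall x, p (g x) = f x.
Proof.
move=> injI liftS.
pose F : set (B * I) := [set z | p z.2 = f z.1]%classic.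
have [|G [pG _ GF maxG]] := partial_graph_maximal (F := F) (@partial_graph0 _ B I).
  by move=> _ ->; rewrite /F /= !linear0.
have [Gz GP Gf] := pG.
have [b|g gE] := partial_graph_total pG; last first.
  by exists g => x; apply: (GF (x, g x)); apply/gE.
apply: contrapT => nb.
pose dom x := exists i, G (x, i).
have domP a x y : dom x -> dom y -> dom (a *: x + y).
  by move=> [i Gi] [j Gj]; exists (a *: i + j); apply: (GP a (x, i) (y, j)).
have dom0 : dom 0 by exists 0.
have [|c [Uc cmin]] := @simple_multiple (fun r => dom (r *: b)).
  by rewrite scale1r.
pose b1 := c *: b.
pose J : {pred R^o} := fun r => `[< dom (r *: b1) >].
have subJ : submod_closed J.
  split; first by apply/asboolP; rewrite scale0r.
  move=> a x y /asboolP dx /asboolP dy; apply/asboolP.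
  by rewrite scalerDl -scalerA; apply: domP.
pose S : lmodType R := quotmod subJ.
have simS : simple_mod S.
  split=> [zS|V subV].
    have /qpi_eq0/asboolP : qpi subJ 1 = 0 by apply: zS.
    by rewrite scale1r.
  have [[u [Vu nu0]]|noV] := pselect (exists u, u \in V /\ u <> 0); last first.
    by left=> u Vu; apply: contrapT => nu; apply: noV; exists u.
  right=> w; have [V0 VP] := subV.
  have VZ a x : x \in V -> a *: x \in V by move=> Vx; rewrite -[_ *: _]addr0 VP.
  have nJ : ~ dom ((val u : R) * c *: b).
    move=> du; apply: nu0; rewrite -(qpi_val u); apply/qpi_eq0/asboolP.
    by rewrite /b1 scalerA.
  have [d dE] := cmin _ nJ.
  have E1 : d *: u = qpi subJ 1.
    rewrite -[in LHS](qpi_val u) -linearZ; apply/qpiP/asboolP.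
    rewrite -[X in dom X]/((d * (val u : R) - 1 : R) *: b1).
    by rewrite scalerBl scale1r /b1 scalerA -mulrA dE subrr.
  have -> : w = (val w : R) *: qpi subJ 1.
    by rewrite -linearZ -[RHS]/(qpi subJ ((val w : R) * 1 : R)) mulr1 qpi_val.
  by rewrite -E1; exact/VZ/VZ.
(* The graph of [G] is itself a module; its first projection embeds it in [B] as the domain, and its
   second is the map that injectivity of [I] extends. *)
have Gsub : submod_closed ((fun z => `[< G z >]) : {pred (B * I)%type}).
  split=> [|a x y /asboolP Gx /asboolP Gy]; apply/asboolP => //.
  exact: GP.
pose GM : lmodType R := submod Gsub.
have inG (u : GM) : G (val u) by apply/asboolP; case: u.
have fst_inj : injective (fst \o sub_incl Gsub : {linear GM -> B}).
  move=> u v E; have {}E : (val u).1 = (val v).1 := E; apply: val_inj.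
  have := GP (-1) _ _ (inG v) (inG u); rewrite scaleN1r.
  case: (val u) (val v) E => [u1 u2] [v1 v2] /= ->.
  rewrite -[_ + _]/(- v1 + v1, - v2 + u2) addNr => /Gf /eqP.
  by rewrite addrC subr_eq0 => /eqP ->.
have [g' g'E] := injI _ _ _ (snd \o sub_incl Gsub : {linear GM -> I}) fst_inj.
have g'G x i : G (x, i) -> g' x = i.
  move=> Gxi; have Gt : (x, i) \in sub_pred Gsub by apply/asboolP.
  exact: (g'E (exist _ (x, i) Gt)).
(* [w] measures the failure of [g'] to lift [f] at [b1]. It is annihilated by [J], since [g'] agrees
   with [G] on the domain. *)
pose w := f b1 - p (g' b1).
have [|h hE] := @linear_exists _ R^o I2 (fun r : R^o => (r : R) *: w).
  by move=> a r s; rewrite scalerDl -scalerA.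
have [|||u uE] := @factor_surj _ _ _ _ _ (sub_incl subJ) (qpi subJ) h.
- by move=> t; exists (val t); exact: qpi_val.
- by move=> r; rewrite qpi_eq0; apply: sub_inclP.
- move=> t; have /sub_inclP/asboolP[i Gi] : exists t', sub_incl subJ t' = sub_incl subJ t by exists t.
  rewrite hE /w scalerBr -!linearZ /= (g'G _ _ Gi) -(GF _ Gi) /=.
  exact: subrr.
have [v vE] := liftS S simS u.
pose y := v (qpi subJ 1).
have py : p y = w by rewrite vE uE hE scale1r.
have Jy r : dom (r *: b1) -> r *: y = 0.
  move=> dr; have E : r *: qpi subJ 1 = 0.
    rewrite -linearZ; apply/qpi_eq0/asboolP.
    by rewrite -[X in dom X]/((r * 1 : R) *: b1) mulr1.
  by rewrite /y -linearZ /= E linear0.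
(* The value [g' b1 + y] lies over [f b1], and [G'] is single-valued because [J] annihilates [y]. *)
pose G' : set (B * I) := [set z | exists x i r,
  G (x, i) /\ z = (x + r *: b1, i + r *: (g' b1 + y))]%classic.
apply: Uc; exists (g' b1 + y); apply: (maxG G'); last first.
- by exists 0, 0, 1; split=> //; rewrite !add0r !scale1r.
- have pw : p (g' b1) + w = f b1 by rewrite /w addrC subrK.
  move=> _ [x [i [r [Gxi ->]]]]; rewrite /F /= (linearD p) linearZ /= (linearD p) py pw.
  by rewrite (linearD f) [f (r *: _)]linearZ /= (GF _ Gxi).
- by move=> [x i] Gxi; exists x, i, 0; rewrite !scale0r !addr0.
split.
- by exists 0, 0, 0; split=> //; rewrite !scale0r !addr0.
- move=> a _ _ [x1 [i1 [r1 [G1 ->]]]] [x2 [i2 [r2 [G2 ->]]]].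
  exists (a *: x1 + x2), (a *: i1 + i2), (a * r1 + r2); split.
    exact: (GP a (x1, i1) (x2, i2)).
  rewrite -[LHS]/(_, _) /=; congr (_, _);
    by rewrite scalerDr [in RHS]scalerDl -scalerA addrACA.
move=> j [x [i [r [Gxi [/esym/eqP]]]]]; rewrite addrC addr_eq0 => /eqP rb ->.
have Gr : G (r *: b1, - i).
  have := GP (-1) _ _ Gxi Gz; rewrite addr0 scaleN1r rb.
  by rewrite -[- (x, i)]/(- x, - i).
rewrite scalerDr Jy ?addr0; last by exists (- i).
by rewrite -linearZ (g'G _ _ Gr) subrr.
Qed.
End SimpleLift.

(** * Evaluation into the bidual *)

Section Bidual.
Variables (K : fieldType) (m : nat) (R R' : pzRingType).
Variables (A : fdalg K m R) (A' : fdalg K m R').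
Variables (T : anti_iso A A') (T' : anti_iso A' A).
Hypothesis TT' : forall a, T (T' a) = a.
Implicit Types M N P I : lmodType R.

Definition bidual M : lmodType R := dual T' (dual T M).
Definition bimap M N (f : {linear M -> N}) : {linear bidual M -> bidual N} :=
  dmap (T := T') (dmap (T := T) f).

Section Evaluation.
Variable M : lmodType R.
Let bievP (x : M) k (f g : dual T M) : (emb A' k *: f + g) x = k * f x + g x.
Proof. by rewrite dualDE dual_kscaleE. Qed.
(* The hypothesis is an argument so that the linear structure of [biev], which
   depends on it, can be inferred. *)
Definition biev of (forall a, T (T' a) = a) := fun x : M => Dual T' (bievP x) : bidual M.
Let biev_linear : linear (biev TT').
Proof.
move=> a x y; apply: dual_ext => f /=.
by rewrite dfunD -[a in LHS]TT'.
Qed.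
HB.instance Definition _ := GRing.isLinear.Build R M (bidual M) _ (biev TT') biev_linear.

Lemma bievE x (f : dual T M) : biev TT' x f = f x. Proof. by []. Qed.

Lemma biev_eq0 x : biev TT' x = 0 -> x = 0.
Proof.
move=> x0; apply: contrapT => nx.
have [//||//|g [_ gx]] := @vect_separation K (kmod A M) [set 0]%classic x.
  by move=> a y z -> ->; rewrite scaler0 addr0.
have [f fE] := linear_dual T g.
have /eqP := bievE x f; rewrite x0 fE gx eq_sym; exact/negP/oner_neq0.
Qed.
End Evaluation.

(** A [K]-linear retraction [t] of the evaluation is averaged over the doubly transposed splitting,
    which restricts to the splitting of [P] along the evaluation. *)
Lemma biev_retraction P : projective_mod P ->
  exists r : {linear bidual P -> P}, forall x, r (biev TT' x) = x.
Proof.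
case/(projective_proj_splitting A) => sg sgP.
have [|t tE] := @vect_extension K (kmod A P) (kmod A (bidual P)) (kmod A P)
    (@biev P TT') idfun (klinear (A := A) (@biev P TT')) (fun _ _ _ => erefl).
  by move=> x /biev_eq0.
have [r rE] := proj_splitting_average t (dual_inj_splitting T' (dual_proj_splitting T sgP)).
exists r => x; rewrite rE -[RHS](sgP.1 x); apply: eq_bigr => i _.
congr (_ *: _); rewrite -[RHS]tE; congr (t _).
exact: dual_ext.
Qed.

(** The dual of [s] sends the evaluation at [d x] to the evaluation at [x], because
    [(s f) (d x) = f x]; the bidual of [P] then retracts onto [P]. *)
Lemma dual_section_retraction P N (d : {linear P -> N})
    (s : {linear dual T P -> dual T N}) :
  projective_mod P -> (forall f, dmap d (s f) = f) ->
  exists r : {linear N -> P}, forall x, r (d x) = x.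
Proof.
move=> /biev_retraction[r rE] sK.
exists (r \o (dmap (T := T') s \o @biev N TT')) => x /=; rewrite -[RHS]rE; congr (r _).
apply: dual_ext => f; rewrite dmapE !bievE -[in RHS](sK f).
by rewrite dmapE.
Qed.

(** [q] projects [R] onto the annihilator of [s0], which is thus spanned over [K] by the finitely
    many [q (bas A i)]. *)
Lemma left_ideal_projection (S : lmodType R) (s0 : S) :
  exists q : {linear kmod A R^o -> kmod A R^o},
    (forall a, (q a : R) *: s0 = 0) /\ forall a : R, a *: s0 = 0 -> q a = a.
Proof.
pose F : set (kmod A R^o * kmod A R^o) := [set z | (z.2 : R) *: s0 = 0]%classic.
pose G0 : set (kmod A R^o * kmod A R^o) := [set z | z.1 = z.2 /\ F z]%classic.
have FP a x y : F x -> F y -> F (a *: x + y).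
  rewrite /F /= => x0 y0.
  rewrite -[X in X *: _]/((emb A a * (x.2 : R) + y.2)) scalerDl -scalerA.
  by rewrite x0 y0 scaler0 addr0.
have [|||q [qG0 qF]] := @vect_extend K (kmod A R^o) (kmod A R^o) G0 F _ _ FP.
- split=> [|a x y [x1 Fx] [y1 Fy]|i [//]].
    by split=> //; rewrite /F /= scale0r.
  by split; [rewrite /= x1 y1 | apply: FP].
- by move=> z [].
- by move=> b; exists 0; rewrite /F /= scale0r.
by exists q; split=> [a|a a0]; [apply: (qF a) | apply: qG0].
Qed.

(* A lift of [f] amounts to a solution of a finite linear system over [I1], and
   a K-linear functional separating the right-hand side from the values of the
   system would also separate it in the bidual, where [g] solves the system. *)
Lemma bidual_lift I1 I2 (p : {linear I1 -> I2}) (S : lmodType R)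
    (f : {linear S -> I2}) (g : {linear S -> bidual I1}) :
  simple_mod S -> (forall x, bimap p (g x) = biev TT' (f x)) ->
  exists h : {linear S -> I1}, forall x, p (h x) = f x.
Proof.
move=> /simple_cyclic[s0 s0P] gE.
have [q [q0 qJ]] := left_ideal_projection s0.
have [y [py qy]] : exists y, p y = f s0 /\ forall i, (q (bas A i) : R) *: y = 0.
  (* [sys y] collects the conditions on [y] as image of [s0]: its value under [p] and the relations
     satisfied by [s0]. *)
  pose W : lmodType K := (kmod A I2 * {ffun 'I_m -> kmod A I1})%type.
  pose sys (y : I1) : W := (p y, [ffun i => (q (bas A i) : R) *: y]).
  have sysP a x y : sys (emb A a *: x + y) = a *: sys x + sys y.
    rewrite /sys -[RHS]/(_, _) /= linearP; congr (_, _).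
    apply/ffunP => i; rewrite !ffunE scalerDr scalerA -emb_comm.
    by rewrite -scalerA.
  apply: contrapT => nosol.
  pose U : set W := [set w | exists y, w = sys y]%classic.
  have [|||psi [psiU psi1]] := @vect_separation K W U (f s0 : kmod A I2, 0).
  - exists 0; rewrite /sys linear0; congr (_, _).
    by apply/ffunP => i; rewrite !ffunE scaler0.
  - by move=> a _ _ [x ->] [y ->]; exists (emb A a *: x + y); rewrite sysP.
  - move=> [y [py /ffunP qy]]; apply: nosol; exists y; split=> // i.
    by have := qy i; rewrite !ffunE.
  have [|al alE] := @linear_exists K (kmod A I2) K^o (fun x => psi (x, 0)).
    move=> a x y; rewrite -(linearP psi); congr (psi _).
    by rewrite -[RHS]/(_, _) /= scaler0 addr0.
  have [al' al'E] := linear_dual T al.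
  pose del i (y : I1) : {ffun 'I_m -> kmod A I1} :=
    [ffun k => if k == i then (y : kmod A I1) else 0].
  have sum_del (z : 'I_m -> I1) : \sum_i ((0, del i (z i)) : W) = (0, [ffun i => z i]).
    rewrite [LHS]surjective_pairing (linear_sum fst) (linear_sum snd) /= big1 //.
    congr (_, _); apply/ffunP => k; rewrite sum_ffunE ffunE (bigD1 k) //= ffunE eqxx.
    by rewrite big1 ?addr0 // => i ik; rewrite ffunE eq_sym (negPf ik).
  have lin_be i : linear (fun y : kmod A I1 => psi (0, del i y) : K^o).
    move=> a x y; rewrite -(linearP psi); congr (psi _).
    rewrite -[RHS]/(_, _) /= scaler0 addr0; congr (_, _).
    by apply/ffunP => k; rewrite !ffunE; case: (k == i); rewrite ?scaler0 ?addr0.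
  have /choice[be beE] := fun i => linear_exists (lin_be i).
  have /choice[be' be'E] := fun i => linear_dual T (be i).
  (* As [psi] vanishes on every [sys y], its components satisfy this relation in the dual of [I1].
     Applying [g s0] to it yields [1 = 0]: the first term gives [psi (f s0, 0)], and the others
     vanish with [q (bas A i) *: s0]. *)
  have rel0 : dmap p al' + \sum_i T' (q (bas A i)) *: be' i = 0.
    apply: dual_ext => y; rewrite dualDE dmapE dual_sumE dual0E al'E alE.
    under eq_bigr => i _ do rewrite dualZE TT' be'E beE.
    rewrite -linear_sum -linearD; apply: psiU; exists y; rewrite sum_del.
    by rewrite -[LHS]/(_, _) /= addr0 add0r.
  have := dfun0 (g s0); rewrite -rel0 dfunD dfun_sum big1 ?addr0 => [|i _].
    rewrite -[LHS]/(bimap p (g s0) al') gE bievE al'E alE psi1.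
    by move/eqP; rewrite oner_eq0.
  by rewrite -dualZE -linearZ /= q0 linear0.
have Jy a : a *: s0 = 0 -> a *: y = 0.
  move=> /qJ qa; rewrite -[a]qa {1}(bas_crd A a).
  rewrite (linear_sum q) scaler_suml big1 // => i _.
  have -> : q (emb A (crd A i a) * bas A i) = emb A (crd A i a) * q (bas A i).
    exact: linearZ.
  by rewrite -scalerA qy scaler0.
have [|h0 h0E] := @linear_exists _ R^o I1 (fun a : R^o => (a : R) *: y).
  by move=> a r s; rewrite scalerDl -scalerA.
have [|c cE] := @linear_exists _ R^o S (fun a : R^o => (a : R) *: s0).
  by move=> a r s; rewrite scalerDl -scalerA.
have [|||h hE] := @factor_surj _ _ _ _ _ (ker_incl c) c h0.
- by move=> x; have [a ->] := s0P x; exists a; rewrite cE.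
- exact: ker_incl_exact.
- move=> u; rewrite h0E; apply: Jy; rewrite -cE.
  by apply/ker_incl_exact; exists u.
exists h => x; have [a ->] := s0P x.
by rewrite -cE hE h0E cE !linearZ /= py.
Qed.
End Bidual.

(** * Comparison of the invariants *)

Section DeloopingLevels.
Variables (K : fieldType) (m : nat) (R : pzRingType) (A : fdalg K m R).
Implicit Types M X S : lmodType R.

Lemma coh_zero_Ext_zero n M X (I : coresolution X) :
  (forall i, injective_mod (I i)) -> coh_zero I n M -> Ext_zero n.+1 M X.
Proof.
move=> injI cM; have [Q pQ] := projective_resolution A M.
by exists Q; split=> //; apply/(Ext_coh injI).
Qed.

Lemma Ext_zero_coh_zero n M X (I : coresolution X) :
  (forall i, injective_mod (I i)) -> Ext_zero n.+1 M X -> coh_zero I n M.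
Proof. by move=> injI [Q [pQ eQ]]; apply: (Ext_coh injI n pQ).1. Qed.

Lemma coh_zero_indep n M X (I J : coresolution X) :
  (forall i, injective_mod (I i)) -> (forall i, injective_mod (J i)) ->
  coh_zero I n M -> coh_zero J n M.
Proof. by move=> injI injJ /(coh_zero_Ext_zero injI); apply: Ext_zero_coh_zero. Qed.

(** The offset [k] is one less than in [edell], since [coh_zero I (n + k)] concerns degree
    [n + k + 1]. *)
Lemma edell_le M n :
  (forall k X (I : coresolution X), (forall i, injective_mod (I i)) ->
     length_le (n + k).+1 I -> coh_zero I (n + k) M) ->
  (edell M <= Fin n)%enat.
Proof.
move=> H; apply/nat_inf_leP; exists n => // -[//|k] _ X /nat_inf_Fin[I [injI lI]].
by rewrite addnS in lI *; apply: (coh_zero_Ext_zero injI); apply: H.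
Qed.

Lemma edell_le_ddell M : (edell M <= ddell M)%enat.
Proof.
case E: (ddell M) => [p|]; last by case: (edell M).
have [n [C [le_np lC _ dC]]] := nat_inf_Fin E.
apply: edell_le => k X I injI lI.
apply: (coh_zero_res injI lC) => [|i le_in]; first exact: leq_trans le_np (leq_addr _ _).
have le_ip : (i <= p)%N := leq_trans le_in le_np.
(* The length demanded of [I] is [(p + k - i) + (i + 1) = p + k + 1]. *)
apply: (coh_zero_kdell injI (dC i le_in)); last by rewrite leq_sub2r ?leq_addr.
by rewrite addnS subnK // (leq_trans le_ip) ?leq_addr.
Qed.

Lemma edell_le_sub_ddell M : (edell M <= sub_ddell M)%enat.
Proof.
case E: (sub_ddell M) => [n|]; last by case: (edell M).
have [N [_ [j ij] dN]] := nat_inf_Fin E.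
apply: edell_le => k X I injI lI; apply: (coh_zero_sub injI lI ij).
apply: (coh_zero_kdell injI (k := 1) (m := n)); last exact: leq_addr.
  by rewrite -[kdell _ _]/(dell N) -dN enat_le_refl.
by rewrite addn1.
Qed.

Lemma ddell_le_dell S : simple_mod S -> (ddell S <= dell S)%enat.
Proof.
move=> simS; case E: (dell S) => [n|]; last by case: (ddell S).
(* The sequence [0 -> S -> S -> 0] has length 0, and its level condition is the bound on
   [dell S]. *)
apply/nat_inf_leP; exists n => //; have [C CE] := trivial_res S.
exists 0%N, C; rewrite CE; split=> //.
- by move=> [|i] //= _; apply: zmod0P.
- case=> [|i] /=; first exact: simple_fin_gen.
  by exists 0%N, (fun=> 0) => x; exists (fun=> 0); rewrite [x]zmod0P big_ord0.
- by case=> // _; rewrite subn0 -[kdell _ _]/(dell S) E enat_le_refl.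
Qed.

Lemma sub_ddell_le_dell S : simple_mod S -> (sub_ddell S <= dell S)%enat.
Proof.
move=> simS; case E: (dell S) => [n|]; last by case: (sub_ddell S).
apply/nat_inf_leP; exists n => //; exists S; split=> //; first exact: simple_fin_gen.
by exists idfun.
Qed.
End DeloopingLevels.

(** * Equality of Findim and the effective delooping level *)

Section FindimEdell.
Variables (K : fieldType) (m : nat) (R R' : pzRingType).
Variables (A : fdalg K m R) (A' : fdalg K m R').
Variables (T : anti_iso A A') (T' : anti_iso A' A).
Hypotheses (TT' : forall a, T (T' a) = a) (T'T : forall a, T' (T a) = a).

(** Since [I n.+2] vanishes, all maps from simple modules to [I n.+1] lift, hence so does the
    identity of [I n.+1]. *)
Lemma simple_coh_section n (X : lmodType R') (I : coresolution X) :
  (forall i, injective_mod (I i)) -> length_le n.+1 I ->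
  (forall S, simple_mod S -> coh_zero I n S) ->
  exists s : {linear I n.+1 -> I n}, forall x, cores_diff I n (s x) = x.
Proof.
move=> injI lI cI; apply: (simple_lift A' idfun) => // S simS u.
by apply: cI => // x; apply: lI.
Qed.

Lemma Findim_le_edell : (Findim R <= edell_ring R')%enat.
Proof.
apply: enat_sup_le => _ [M [fM ->]].
case Epd: (projdim M) fM => [n|//] _.
case Eed: (edell_ring R') => [e|//] /=; rewrite leqNgt; apply/negP => lt_en.
have [P [pP lP]] := nat_inf_Fin Epd.
case: n lt_en lP Epd => // n lt_en lP Epd.
pose I := dual_cores T P.
have injI i : injective_mod (I i) by apply: dual_projective.
have lI : length_le n.+1 I by apply: dual_length.
have cI S : simple_mod S -> coh_zero I n S.
  (* [edell S] speaks of modules of injective dimension exactly [n + 1]; if that of [dual T M] is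
     smaller, a shorter coresolution gives the vanishing. *)
  move=> simS; have [[n0 [le_n [J [injJ lJ]]]]|noJ] :=
      pselect (exists n0, (n0 <= n)%N /\ inj_le n0 (dual T M)).
    by apply: (coh_zero_indep A' injJ injI); apply: coh_zero_length lJ le_n.
  have idX : injdim (dual T M) = Fin n.+1.
    have : (injdim (dual T M) <= Fin n.+1)%enat by apply/nat_inf_leP; exists n.+1; last exists I.
    case Ei: (injdim _) => [n1|//] /= le_n1; congr Fin; apply/eqP.
    rewrite eqn_leq le_n1 ltnNge; apply/negP => le_n; apply: noJ; exists n1; split=> //.
    exact: nat_inf_Fin Ei.
  have : (edell S <= Fin e)%enat by rewrite -Eed; apply: enat_sup_ub; exists S.
  case/nat_inf_leP => nS le_nS HS; apply: (Ext_zero_coh_zero injI).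
  have le_Sn : (nS < n.+1)%N := leq_ltn_trans le_nS lt_en.
  rewrite -(subnKC (ltnW le_Sn)); apply: HS; first by rewrite subn_gt0.
  by rewrite subnKC // ltnW.
have [s sE] := simple_coh_section injI lI cI.
have [r rE] := dual_section_retraction TT' (pP n.+1) sE.
have : (projdim M <= Fin n)%enat.
  by apply/nat_inf_leP; exists n => //; apply: (proj_le_pred (r := r)).
by rewrite Epd /= ltnn.
Qed.

(** When [Findim R] is a finite [d], the condition defining [edell] holds vacuously at [d]: no [X]
    has injective dimension [d + k] with [k >= 1]. *)
Lemma edell_le_Findim : (edell_ring R' <= Findim R)%enat.
Proof.
apply: enat_sup_le => _ [S0 [_ ->]].
case Efd: (Findim R) => [d|]; last by case: (edell S0).
apply/nat_inf_leP; exists d => // k k_gt0 X idX; exfalso.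
have [n En] : exists n, (d + k = n.+1)%N by exists (d + k).-1; rewrite prednK // ltn_addl.
have le_dn : (d <= n)%N by rewrite -ltnS -En -addn1 leq_add2l.
rewrite En in idX; have [I [injI lI]] := nat_inf_Fin idX.
have pdX : (projdim (dual T' X) <= Fin n.+1)%enat.
  apply/nat_inf_leP; exists n.+1 => //; exists (dual_res T' I); split.
    by move=> i; apply: dual_injective.
  exact: dual_length.
have : (projdim (dual T' X) <= Fin d)%enat.
  rewrite -Efd; apply: enat_sup_ub; exists (dual T' X); split=> // E.
  by rewrite E in pdX.
case/nat_inf_leP=> d0 le_d0 [Q [pQ lQ]].
(* Both [J] and [II] coresolve the bidual of [X]; [J] has length at most [d], so vanishing in degree
   [n + 1] passes to [II]. *)
pose J := dual_cores T Q.
pose II := dual_cores T (dual_res T' I).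
have injJ i : injective_mod (J i) by apply: dual_projective.
have injII i : injective_mod (II i) by apply/dual_projective/dual_injective.
have cII S : coh_zero II n S.
  apply: (coh_zero_indep A' injJ injII); apply: (coh_zero_length (n := d0)).
    exact: dual_length.
  exact: leq_trans le_dn.
have lift S : simple_mod S -> coh_zero I n S.
  (* The lift is found after evaluation into the bidual and brought back by [bidual_lift]. *)
  move=> simS u _; pose u' : {linear S -> II n.+1} := @biev _ _ _ _ _ _ T' T (I n.+1) T'T \o u.
  have [g gE] : exists g : {linear S -> II n}, forall x, cores_diff II n (g x) = u' x.
    have zII : zero_mod (II n.+2) by apply/dual_zero/dual_zero/lI.
    by apply: cII => x; apply: zII.
  by apply: (bidual_lift (g := g) simS) gE.
have [s sE] := simple_coh_section injI lI lift.
have : (injdim X <= Fin n)%enat.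
  by apply/nat_inf_leP; exists n => //; apply: (inj_le_pred (s := s)).
by rewrite idX /= ltnn.
Qed.
End FindimEdell.

(** * A finite-dimensional algebra and its converse *)

Section FalgData.
Variables (K : fieldType) (L : falgType K).
Let b := vbasis {:L}%VS.
Let e (i : 'I_(\dim {:L})) : L := b`_i.
Let c (i : 'I_(\dim {:L})) : L -> K := coord b i.
Let em (k : K) : L := k%:A.

Let em1 : em 1 = 1. Proof. exact: scale1r. Qed.
Let emD x y : em (x + y) = em x + em y. Proof. exact: scalerDl. Qed.
Let emM x y : em (x * y) = em x * em y.
Proof. by rewrite /em -scalerAl mul1r scalerA. Qed.
Let em_comm x r : em x * r = r * em x.
Proof. by rewrite /em -scalerAl -scalerAr mul1r mulr1. Qed.
Let cP i x r s : c i (em x * r + s) = x * c i r + c i s.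
Proof. by rewrite /c /em -scalerAl mul1r linearP. Qed.
Let c_e i j : c i (e j) = (i == j)%:R.
Proof. by rewrite /c /e coord_free ?(basis_free (vbasisP _)) // eq_sym. Qed.
Let e_c r : r = \sum_i em (c i r) * e i.
Proof.
rewrite {1}(coord_vbasis (memvf r)); apply: eq_bigr => i _.
by rewrite /em -scalerAl mul1r.
Qed.

Definition falg_fdalg : fdalg K (\dim {:L}) L :=
  Fdalg em1 emD emM em_comm cP c_e e_c.

Let em' : K -> L^c := em.
Let e' : 'I_(\dim {:L}) -> L^c := e.
Let emM' x y : em' (x * y) = em' x * em' y.
Proof. exact: etrans (emM x y) (em_comm x _). Qed.
Let em_comm' x (r : L^c) : em' x * r = r * em' x.
Proof. exact: esym (em_comm x r). Qed.
Let cP' i x (r s : L^c) : c i (em' x * r + s) = x * c i r + c i s.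
Proof. by rewrite em_comm'; apply: cP. Qed.
Let e_c' (r : L^c) : r = \sum_i em' (c i r) * e' i.
Proof. by apply: etrans (e_c r) _; apply: eq_bigr => i _; rewrite em_comm'. Qed.

Definition falg_conv_fdalg : fdalg K (\dim {:L}) L^c :=
  @Fdalg K _ L^c em' e' c em1 emD emM' em_comm' cP' c_e e_c'.

(** The identity reverses products when read from [L^c] to [L], so all conditions hold by
    computation. *)
Definition falg_anti : anti_iso falg_fdalg falg_conv_fdalg :=
  @AntiIso K _ L L^c falg_fdalg falg_conv_fdalg id erefl (fun _ _ => erefl)
    (fun _ _ => erefl) (fun _ => erefl) (fun _ => erefl) (fun _ _ => erefl).

Definition falg_conv_anti : anti_iso falg_conv_fdalg falg_fdalg :=
  @AntiIso K _ L^c L falg_conv_fdalg falg_fdalg id erefl (fun _ _ => erefl)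
    (fun _ _ => erefl) (fun _ => erefl) (fun _ => erefl) (fun _ _ => erefl).
End FalgData.

Theorem theorem1p1 (K : fieldType) (Lambda : falgType K) :
  [/\ Findim Lambda = edell_ring Lambda^c,
      (edell_ring Lambda^c <= ddell_ring Lambda^c)%enat,
      (ddell_ring Lambda^c <= dell_ring Lambda^c)%enat,
      (edell_ring Lambda^c <= sub_ddell_ring Lambda^c)%enat
    & (sub_ddell_ring Lambda^c <= dell_ring Lambda^c)%enat].
Proof.
have A' := falg_conv_fdalg Lambda.
split; last by apply: sup_simple_le => S; apply: sub_ddell_le_dell.
- apply: enat_le_anti.
    exact: (Findim_le_edell (T := falg_anti Lambda) (T' := falg_conv_anti Lambda)).
  exact: (edell_le_Findim (T := falg_anti Lambda) (T' := falg_conv_anti Lambda)).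
- by apply: sup_simple_le => S _; apply: edell_le_ddell A' _.
- by apply: sup_simple_le => S; apply: ddell_le_dell.
- by apply: sup_simple_le => S _; apply: edell_le_sub_ddell A' _.
Qed.
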